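(* Let $k\ge 2$ and $N\ge 1$ be integers, let $p,q>1$ be real numbers, let $Q=(0,\infty)\times\mathbb{R}^N$, and consider the problem $$ (\mathrm{P})\qquad \partial_t^k u-\Delta u = |u|^p + |\partial^{k-1}_{t} u|^q+ w(t,x)\quad \text{in } Q. $$ Let $p^*(N)=\infty$ if $N\in\{1,2\}$ and $p^*(N)=\frac{N}{N-2}$ if $N\ge 3$. (I) Let $w(t,x)=g(x)$ with $g\in L^1_{loc}(\mathbb{R}^N)$, $g\geq 0$, $g\not\equiv 0$, and let $q>1$ and $1<p<p^*(N)$. Then problem $(\mathrm{P})$ admits no weak solutions. (II) If $N\geq 3$ and $p>p^*(N)$, then for all $q>1$, problem $(\mathrm{P})$ has global positive solutions for some $w=g(x)>0$ and suitable initial values.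
   Context: Here $\partial_t^i=\frac{\partial^i}{\partial t^i}$ and $\Delta$ is the Laplacian in $x\in\mathbb{R}^N$. $C_c^2(Q)$ denotes the space of $C^2$ real-valued functions compactly supported in $Q=(0,\infty)\times\mathbb{R}^N$. The inhomogeneity $w\ge 0$ is always a nontrivial $L^1_{loc}$ function. Definition (weak solution). A pair $(u,\partial^{k-1}_{t} u)\in L^p_{loc}(Q)\times L^q_{loc}(Q)$ (the time derivative $\partial_t^{k-1}u$ being understood in the sense of distributions on $Q$) is a weak solution to $(\mathrm{P})$ if for every $\varphi\in C_c^2(Q)$, $$ \int_Q \left(|u|^p+|\partial^{k-1}_{t} u|^q+w(t,x)\right)\varphi\,dx\,dt =-\int_Q \partial^{k-1}_t u\,\partial_t \varphi\,dx\,dt-\int_Q u\, \Delta \varphi\,dx\,dt. $$ No conditions on initial values are imposed in this definition. A global positive solution is a solution $u>0$ defined on all of $Q$; stationary (time-independent) solutions are counted as global solutions. The initial values are $\partial_t^i u(0,x)$, $i=0,1,\dots,k-1$; ''for some $w=g(x)>0$ and suitable initial values'' means that there exist a function $g>0$ on $\mathbb{R}^N$ and initial values for which such a solution exists. *)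

(* Defs.v *)
From HB Require Import structures.
From mathcomp Require Import all_boot all_order all_algebra.
From mathcomp Require Import all_classical all_reals all_analysis.

Set Implicit Arguments.
Unset Strict Implicit.
Unset Printing Implicit Defensive.

Import Order.TTheory GRing.Theory Num.Theory.
Import numFieldNormedType.Exports.

Local Open Scope classical_set_scope.
Local Open Scope ring_scope.

Definition measure_rV_display : measure_display.
Proof. exact. Qed.

Section measurable_rV.
Context (R : realType) (n : nat).

Let coord (i : 'I_n) (x : 'rV[R]_n) : R := x ord0 i.

Let rV_set0 : g_sigma_preimage coord set0.
Proof. exact: sigma_algebra0. Qed.

Let rV_setC A : g_sigma_preimage coord A -> g_sigma_preimage coord (~` A).
Proof. exact: sigma_algebraC. Qed.

Let rV_bigcup (F : _^nat) : (forall i, g_sigma_preimage coord (F i)) ->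
  g_sigma_preimage coord (\bigcup_i (F i)).
Proof. exact: sigma_algebra_bigcup. Qed.

(* The product sigma-algebra, generated by the coordinates; since R is second
   countable it is the Borel sigma-algebra of 'rV[R]_n *)
HB.instance Definition _ := @isMeasurable.Build measure_rV_display
  'rV[R]_n (g_sigma_preimage coord) rV_set0 rV_setC rV_bigcup.

Lemma measurable_coord (i : 'I_n) :
  measurable_fun [set: 'rV[R]_n] (fun x : 'rV[R]_n => x ord0 i).
Proof.
move=> _ Y mY; rewrite setTI; apply: sub_sigma_algebra => /=.
rewrite -bigcup_seq/=; exists i => /=; first by rewrite mem_index_enum.
by exists Y => //; rewrite setTI.
Qed.

Lemma measurable_fun_rV d (T : measurableType d) (f : T -> 'rV[R]_n) :
  (forall i, measurable_fun [set: T] (fun t => f t ord0 i)) ->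
  measurable_fun [set: T] f.
Proof.
move=> mf _ A mA; rewrite setTI.
have : preimage_set_system [set: T] f (g_sigma_preimage coord) (f @^-1` A).
  by exists A => //; rewrite setTI.
rewrite -g_sigma_preimage_comp; apply: smallest_sub.
  exact: sigma_algebra_measurable.
elim/big_ind: _ => [//|X Y mX mY|i _ B [C mC <-]].
  by rewrite subUset; split.
exact: mf.
Qed.

End measurable_rV.

Section lebesgue_rV.
Context (R : realType).

Definition cons_rV n (z : R * 'rV[R]_n) : 'rV[R]_n.+1 :=
  \row_i (if unlift ord0 i is Some j then z.2 ord0 j else z.1).

Definition uncons_rV n (x : 'rV[R]_n.+1) : R * 'rV[R]_n :=
  (x ord0 ord0, \row_j x ord0 (lift ord0 j)).

Lemma cons_rV0 n (z : R * 'rV[R]_n) : cons_rV z ord0 ord0 = z.1.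
Proof. by rewrite mxE unlift_none. Qed.

Lemma cons_rVS n (z : R * 'rV[R]_n) i : cons_rV z ord0 (lift ord0 i) = z.2 ord0 i.
Proof. by rewrite mxE liftK. Qed.

Lemma cons_rVK n : cancel (@cons_rV n) (@uncons_rV n).
Proof.
move=> [t x]; rewrite /uncons_rV cons_rV0; congr pair.
by apply/rowP => i; rewrite mxE cons_rVS.
Qed.

Lemma measurable_cons_rV n : measurable_fun setT (@cons_rV n).
Proof.
apply: measurable_fun_rV => i; case: (unliftP ord0 i) => [j|] ->.
- under eq_fun do rewrite cons_rVS.
  exact: measurableT_comp (measurable_coord j) measurable_snd.
- by under eq_fun do rewrite cons_rV0; exact: measurable_fst.
Qed.

Lemma measurable_uncons_rV n : measurable_fun setT (@uncons_rV n).
Proof.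
apply/measurable_fun_pairP; split; first exact: measurable_coord.
apply: measurable_fun_rV => i.
rewrite (_ : (fun _ => _) = fun x : 'rV[R]_n.+1 => x ord0 (lift ord0 i)).
  exact: measurable_coord.
by apply/funext => x; rewrite /= mxE.
Qed.

Section step.
Context n (mu : {sigma_finite_measure set 'rV[R]_n -> \bar R}).

Definition lebesgue_cons : set 'rV[R]_n.+1 -> \bar R :=
  pushforward (lebesgue_measure \x mu)%E (@cons_rV n).

Let lebesgue_cons0 : lebesgue_cons set0 = 0%E.
Proof. by rewrite /lebesgue_cons /pushforward preimage_set0 measure0. Qed.

Let lebesgue_cons_ge0 A : (0 <= lebesgue_cons A)%E.
Proof. exact: (measure_ge0 ((@lebesgue_measure R) \x mu)%E). Qed.

Let lebesgue_cons_sigma_additive : semi_sigma_additive lebesgue_cons.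
Proof.
have mc := @measurable_cons_rV n.
move=> F mF tF mUF; rewrite /lebesgue_cons /pushforward preimage_bigcup.
apply: measure_semi_sigma_additive.
- by move=> m; rewrite -[X in measurable X]setTI; exact: mc.
- apply/trivIsetP => /= i j _ _ ij; rewrite -preimage_setI.
  by move/trivIsetP : tF => /(_ _ _ _ _ ij) ->//; rewrite preimage_set0.
- by rewrite -preimage_bigcup -[X in measurable X]setTI; exact: mc.
Qed.

HB.instance Definition _ := isMeasure.Build _ _ _
  lebesgue_cons lebesgue_cons0 lebesgue_cons_ge0 lebesgue_cons_sigma_additive.

Let lebesgue_cons_sigma_finite : sigma_finite setT lebesgue_cons.
Proof.
have /sigma_finiteP[F [TF ndF Foo]] := sigma_finiteT (@lebesgue_measure R).
have /sigma_finiteP[G [TG ndG Goo]] := sigma_finiteT mu.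
exists (fun i => @uncons_rV n @^-1` (F i `*` G i)).
  rewrite -preimage_bigcup (_ : \bigcup_i _ = setT) ?preimage_setT//.
  rewrite -setXTT TF TG predeqE => -[x y]; split.
    by move=> [i _ []/= ? ?]; split; exists i.
  move=> [/= [i _ Fix] [j _ Gjy]]; exists (maxn i j) => //; split.
  - by move: x Fix; exact/subsetPset/ndF/leq_maxl.
  - by move: y Gjy; exact/subsetPset/ndG/leq_maxr.
move=> i; have [? ?] := Foo i; have [? ?] := Goo i; split.
  rewrite -[X in measurable X]setTI; apply: measurable_uncons_rV => //.
  exact: measurableX.
rewrite /lebesgue_cons /pushforward -comp_preimage.
rewrite (_ : _ \o _ = id); last by apply/funext => z /=; rewrite cons_rVK.
by rewrite preimage_id product_measure1E// lte_mul_pinfty// ge0_fin_numE.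
Qed.

HB.instance Definition _ := Measure_isSigmaFinite.Build _ _ _
  lebesgue_cons lebesgue_cons_sigma_finite.

End step.

Fixpoint lebesgue_rV n : {sigma_finite_measure set 'rV[R]_n -> \bar R} :=
  match n with
  | 0 => \d_(0 : 'rV[R]_0)
  | n'.+1 => lebesgue_cons (lebesgue_rV n')
  end.

Lemma lebesgue_rV_box n (A : 'I_n -> set R) : (forall i, measurable (A i)) ->
  lebesgue_rV n [set x | forall i, A i (x ord0 i)] =
  (\prod_(i < n) lebesgue_measure (A i))%E.
Proof.
elim: n A => [|n IH] A mA /=.
  by rewrite big_ord0 diracE mem_set// => -[].
rewrite big_ord_recl -IH//= /lebesgue_cons /pushforward.
rewrite [X in product_measure1 _ _ X](_ : _ = A ord0 `*`
    [set x : 'rV[R]_n | forall i : 'I_n, A (lift ord0 i) (x ord0 i)]); last first.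
  apply/seteqP; split => [z /= H|z /= [H0 HS] i].
    split => [|i]; first by have := H ord0; rewrite cons_rV0.
    by have := H (lift ord0 i); rewrite cons_rVS.
  by case: (unliftP ord0 i) => [j|] ->; rewrite (cons_rVS,cons_rV0)//; exact: HS.
rewrite product_measure1E//; first exact: mA.
rewrite [X in measurable X](_ : _ = \bigcap_(i in [set: 'I_n])
    ((fun x : 'rV[R]_n => x ord0 i) @^-1` A (lift ord0 i))).
  apply: fin_bigcap_measurable => // i _; rewrite -[X in measurable X]setTI.
  exact: measurable_coord.
by apply/seteqP; split => x /= H i; [move=> _; exact: H|exact: H].
Qed.

End lebesgue_rV.

Arguments lebesgue_rV {R} n.

Definition support_of (V : topologicalType) (R : realType) (f : V -> R) : set V :=
  closure [set z | f z != 0].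

(* C^n regularity on a finite-dimensional space: all iterated directional
   derivatives of order at most n exist and are continuous *)
Fixpoint class_C (R : realType) (V : normedModType R) (n : nat) (f : V -> R)
    : Prop :=
  continuous f /\
  match n with
  | 0 => True
  | m.+1 => forall v : V, (forall z, derivable f z v) /\
                          class_C m (fun z => 'D_v f z)
  end.

(* An element of C_c^n(Om), Om open, is identified with its extension by zero
   to the whole space *)
Definition test_function (R : realType) (V : normedModType R) (n : nat)
    (Om : set V) (f : V -> R) : Prop :=
  [/\ class_C n f, compact (support_of f) & support_of f `<=` Om].

Section spacetime.
Context (R : realType) (N : nat).
Local Notation space := 'rV[R]_N.
Local Notation mu := (lebesgue_measure \x @lebesgue_rV R N)%E.
Implicit Types (u v w phi : R * space -> R) (Om : set (R * space)).

Definition halfspace : set (R * space) := [set z | 0 < z.1].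

Definition Dt phi : R * space -> R :=
  fun z => 'D_((1, 0) : R * space) phi z.

Definition Dx (i : 'I_N) phi : R * space -> R :=
  fun z => 'D_((0, delta_mx ord0 i) : R * space) phi z.

Definition laplacian phi : R * space -> R :=
  fun z => \sum_(i < N) Dx i (Dx i phi) z.

Definition Lp_loc (p : R) Om u : Prop :=
  measurable_fun Om u /\
  forall K : set (R * space), K `<=` Om -> compact K ->
    (\int[mu]_(z in K) (`|u z| `^ p)%:E < +oo)%E.

Definition L1_loc_space (g : space -> R) : Prop :=
  measurable_fun setT g /\
  forall K : set space, compact K ->
    (\int[lebesgue_rV N]_(x in K) `|g x|%:E < +oo)%E.

Definition distributional_Dt (n : nat) Om u v : Prop :=
  forall psi, (forall m, test_function m Om psi) ->
    \int[mu]_(z in Om) (u z * iter n Dt psi z) =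
    (-1) ^+ n * \int[mu]_(z in Om) (v z * psi z).

(* weak solution of Dt^k u - laplacian u = |u|^p + |Dt^(k-1) u|^q + w in
   halfspace; v stands for Dt^(k-1) u *)
Definition weak_solution (k : nat) (p q : R) w u v : Prop :=
  [/\ Lp_loc p halfspace u,
      Lp_loc q halfspace v,
      distributional_Dt k.-1 halfspace u v &
      forall phi, test_function 2 halfspace phi ->
        \int[mu]_(z in halfspace)
           ((`|u z| `^ p + `|v z| `^ q + w z) * phi z) =
        - (\int[mu]_(z in halfspace) (v z * Dt phi z))
        - \int[mu]_(z in halfspace) (u z * laplacian phi z)].

(* Dt^i u (0, x) is understood as the limit of Dt^i u (t, x) as t tends to 0
   from the right *)
Definition has_initial_values (k : nat) u (u0 : 'I_k -> space -> R) : Prop :=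
  forall (i : 'I_k) (x : space),
    (forall (j : nat) (t : R), (j < i)%N -> 0 < t ->
       derivable (derive1n j (fun s => u (s, x))) t 1) /\
    derive1n i (fun s => u (s, x)) t @[t --> 0^'+] --> u0 i x.

Definition pstar : \bar R :=
  if (N <= 2)%N then +oo%E else (N%:R / (N%:R - 2))%:E.

End spacetime.

Arguments halfspace {R N}.
Arguments pstar R N : clear implicits.

(* Main.v *)
Require Import Defs.
From HB Require Import structures.
From mathcomp Require Import all_boot all_order all_algebra.
From mathcomp Require Import all_classical all_reals all_analysis.
From mathcomp Require Import measurable_realfun ring lra.

Set Implicit Arguments.
Unset Strict Implicit.
Unset Printing Implicit Defensive.

Import Order.TTheory GRing.Theory Num.Theory.
Import numFieldNormedType.Exports.

Local Open Scope classical_set_scope.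
Local Open Scope ring_scope.

(** Nonexistence: test the equation with a product of bumps, of width [T] in
    time and [r] in space, each bump being a high power of [1 - s^2].  Young's
    inequality absorbs [u laplacian phi] and [v Dt phi] into [|u|^p phi] and
    [|v|^q phi], and leaves, with [p'] and [q'] the conjugate exponents,
    [T * \int_(|x| <= r/2) g <= C T r^N (T^-q' + r^-2p')].  Divide by [T] and
    let [T], then [r] tend to infinity: [p < N/(N-2)] says exactly that
    [N < 2p'], so that [g = 0].

    Existence: take [u = c (1 + |x|^2)^-a] with [a = 1/(p-1)] and [v = 0].  Then
    [a < (N-2)/2], so that [- laplacian u] is positive of order
    [c (1 + |x|^2)^(-a-1)], while [u^p = c^p (1 + |x|^2)^(-a-1)] is smaller for
    small [c]; put [g = - laplacian u - u^p]. *)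

(** * Continuous functions are measurable for the product sigma-algebra *)

(** Nonexistence: the exponent of the bumps only has to exceed a threshold. Each derivative of
    [(1 - s^2)^L] costs one factor [1 - s^2], and Young's inequality divides by the lost factors
    raised to the conjugate exponent; [L >= 2p'] and [L >= q'] keep the quotient bounded up to the
    edge of the support. The time bump is centred at [2T], so its support [[T, 3T]] avoids [t = 0],
    where nothing is assumed. The space cutoff is a product over coordinates: a derivative touches
    one factor, the others are at most 1, and the regions are cubes of explicit volume. The order of
    the limits matters, since [r^N T^-q'] is small only once [r] is fixed.

    Existence: the work lies in moving the pointwise Laplacian of [u] onto the test function. This
    rests on the vanishing integral of a derivative of compactly supported functions; as Lebesgue
    measure is built one coordinate at a time, that is proved by Fubini and induction on the
    dimension. The constant [c] solves [c^(p-1) = a (N - 2 - 2a)], so that [u^p] takes exactly half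
    of the leading term of [- laplacian u]. *)

Section measurability.
Context (R : realType) (n : nat).

Lemma measurable_rV_box (A : 'I_n -> set R) : (forall i, measurable (A i)) ->
  measurable [set x : 'rV[R]_n | forall i, A i (x ord0 i)].
Proof.
move=> mA; rewrite [X in measurable X](_ : _ = \bigcap_(i in [set: 'I_n])
    ((fun x : 'rV[R]_n => x ord0 i) @^-1` A i)).
  apply: fin_bigcap_measurable => // i _; rewrite -[X in measurable X]setTI.
  exact: measurable_coord.
by apply/seteqP; split => x /= H i; [move=> _; exact: H|exact: H].
Qed.

(* An open set is the union of the half-open cubes of the grids of mesh
   [1/(m+1)] that it contains. *)
Lemma open_measurable_rV (U : set 'rV[R]_n) : open U -> measurable U.
Proof.
move=> oU.
pose cube (mk : nat * 'rV[int]_n) := [set x : 'rV[R]_n | forall i,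
  [set` `[(mk.2 ord0 i)%:~R / mk.1.+1%:R, (mk.2 ord0 i + 1)%:~R / mk.1.+1%:R[ ]
  (x ord0 i)].
rewrite (_ : U = \bigcup_mk
    (if `[< cube mk `<=` U >] then cube mk else set0)); last first.
  apply/seteqP; split => x; last first.
    by move=> [mk _]; case: asboolP => // sub /sub.
  move=> Ux; have /nbhs_ballP[e /= e0 beU] : nbhs x U by exact: open_nbhs_nbhs.
  have [m _ me] : exists2 m : nat, True & m.+1%:R^-1 < e.
    exists (Num.truncn e^-1) => //.
    by rewrite invf_plt ?posrE// truncnS_gt.
  have m0 : 0 < m.+1%:R :> R by rewrite ltr0n.
  pose k : 'rV[int]_n := \row_i Num.floor (x ord0 i * m.+1%:R).
  exists (m, k) => //; rewrite ifT; last first.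
    apply/asboolP => y ky; apply: beU; rewrite /ball/=; split => // j i.
    rewrite ord1; have := ky i.
    rewrite /ball/= in_itv/= !mxE ler_pdivrMr// ltr_pdivlMr// intrD => yi.
    have xi1 := floor_le_tmp (x ord0 i * m.+1%:R).
    have xi2 := floorD1_gt (x ord0 i * m.+1%:R).
    apply: lt_trans me; rewrite -[ltRHS]mul1r ltr_pdivlMr//.
    rewrite -[X in _ * X]gtr0_norm// -normrM ltr_norml mulrBl.
    rewrite intrD in xi2.
    move/andP : yi xi1 xi2 => []; set a := _%:~R; set b := x _ _ * _.
    set c := y _ _ * _; rewrite (_ : 1%:~R = 1)//.
    by move=> *; lra.
  move=> i /=; rewrite in_itv/= !mxE ler_pdivrMr// ltr_pdivlMr//.
  by rewrite floor_le_tmp floorD1_gt.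
apply: countable_bigcupT_measurable; first exact: countableP.
move=> mk; case: asboolP => // _.
apply: (@measurable_rV_box (fun i => [set` `[(mk.2 ord0 i)%:~R / mk.1.+1%:R,
  (mk.2 ord0 i + 1)%:~R / mk.1.+1%:R[ ])) => i; exact: measurable_itv.
Qed.

Lemma continuous_measurable_rV (f : 'rV[R]_n -> R) :
  continuous f -> measurable_fun setT f.
Proof.
move=> /continuousP cf; apply: (measurability _ (RGenOpens.measurableE R)).
move=> _ [_ [a [b ->] <-]]; rewrite setTI; apply: open_measurable_rV.
by apply: (cf `]a, b[%classic); exact: interval_open.
Qed.

Lemma cons_rV_continuous : continuous (@cons_rV R n).
Proof.
move=> z U /nbhs_ballP[e /= e0 beU]; apply/nbhs_ballP; exists e => //= y [y1 y2].
apply: beU; split => // i j; rewrite (ord1 i) -(ord1 ord0).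
case: (unliftP ord0 j) => [l|] ->; rewrite !(cons_rVS,cons_rV0)//.
by case: y2 => _ H; exact: H.
Qed.

Lemma uncons_rV_continuous : continuous (@uncons_rV R n).
Proof.
move=> z U /nbhs_ballP[e /= e0 beU]; apply/nbhs_ballP; exists e => //= y [_ yz].
apply: beU; split; first exact: yz.
by split => // i j; rewrite !mxE; exact: yz.
Qed.

Lemma cons_unconsK : cancel (@uncons_rV R n) (@cons_rV R n).
Proof.
move=> x; apply/rowP => i.
by case: (unliftP ord0 i) => [l|] ->; rewrite (cons_rVS,cons_rV0)//= mxE.
Qed.

End measurability.

Section measurability_product.
Context (R : realType) (n : nat).

(** [cons_rV] is a homeomorphism onto the row vectors of size [n.+1] and is measurable, so the
    result for row vectors pulls back to the product. *)
Lemma open_measurable_prod (U : set (R * 'rV[R]_n)) : open U -> measurable U.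
Proof.
move=> oU; rewrite (_ : U =
  setT `&` @cons_rV R n @^-1` (@uncons_rV R n @^-1` U)).
  apply: measurable_cons_rV => //; apply: open_measurable_rV.
  by apply: open_comp => // x _; exact: uncons_rV_continuous.
by rewrite setTI -comp_preimage; apply/seteqP; split => z /=; rewrite cons_rVK.
Qed.

Lemma continuous_measurable_prod (f : R * 'rV[R]_n -> R) :
  continuous f -> measurable_fun setT f.
Proof.
move=> /continuousP cf; apply: (measurability _ (RGenOpens.measurableE R)).
move=> _ [_ [a [b ->] <-]]; rewrite setTI; apply: open_measurable_prod.
by apply: (cf `]a, b[%classic); exact: interval_open.
Qed.

Lemma compact_measurable_rV (K : set 'rV[R]_n) : compact K -> measurable K.
Proof.
move=> /(compact_closed (@norm_hausdorff _ _)) cK; rewrite -[K]setCK.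
by apply: measurableC; apply: open_measurable_rV; exact: closed_openC.
Qed.

Lemma compact_measurable_prod (K : set (R * 'rV[R]_n)) :
  compact K -> measurable K.
Proof.
move=> /(compact_closed (@norm_hausdorff _ _)) cK; rewrite -[K]setCK.
by apply: measurableC; apply: open_measurable_prod; exact: closed_openC.
Qed.

End measurability_product.

(** * Cubes, slabs and the integrability of compactly supported continuous functions *)

Lemma continuous_compact_bounded (R : realType) (V : normedModType R)
    (f : V -> R) (K : set V) :
  continuous f -> compact K -> [bounded f x | x in K].
Proof.
move=> cf cK; have cfK : compact (f @` K).
  by refine (continuous_compact _ cK); exact: continuous_subspaceT.
have [M [Mr FM]] := compact_bounded cfK.
by exists M; split=> // M' MM' x Kx; apply: FM MM' _ _; exists x.
Qed.

Section compactly_supported_integral.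
Context (R : realType).

(** For [A >= 0], the closed ball of the sup norm, written coordinatewise so that [lebesgue_rV_box]
    gives its volume. *)
Definition rV_cube n (A : R) :=
  [set x : 'rV[R]_n | forall i, `[- A, A]%classic (x ord0 i)].

Lemma rV_cube_compact n A : compact (@rV_cube n A).
Proof.
apply: (rV_compact (A := fun=> `[- A, A]%classic)) => _.
exact: segment_compact.
Qed.

Lemma rV_cube_measurable n A : measurable (@rV_cube n A).
Proof. by apply: compact_measurable_rV; exact: rV_cube_compact. Qed.

Lemma lebesgue_segment (a b : R) : a <= b ->
  lebesgue_measure (`[a, b]%classic : set R) = (b - a)%:E.
Proof.
move=> ab; rewrite lebesgue_measure_itv/= lte_fin; case: ltP => [_|ba].
  by rewrite EFinB.
by congr EFin; lra.
Qed.

Lemma lebesgue_sym_segment (A : R) : 0 <= A ->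
  lebesgue_measure (`[- A, A]%classic : set R) = (A *+ 2)%:E.
Proof.
by move=> A0; rewrite lebesgue_segment; [congr EFin; ring|lra].
Qed.

Lemma lebesgue_rV_cube n A : 0 <= A ->
  lebesgue_rV n (@rV_cube n A) = ((A *+ 2) ^+ n)%:E.
Proof.
move=> A0; rewrite (@lebesgue_rV_box _ _ (fun=> `[- A, A]%classic))//.
under eq_bigr => i _ do rewrite lebesgue_sym_segment//.
by rewrite prodEFin prodr_const card_ord.
Qed.

Lemma rV_cube_fin n A : 0 <= A -> (lebesgue_rV n (@rV_cube n A) < +oo)%E.
Proof. by move=> A0; rewrite lebesgue_rV_cube// ltry. Qed.

Lemma rV_coord_norm n (x : 'rV[R]_n) i : `|x ord0 i| <= `|x|.
Proof.
rewrite [leRHS]mx_normrE.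
exact: (@le_bigmax _ _ _ _ (fun ij => `|x ij.1 ij.2|) (ord0, i)).
Qed.

Lemma rV_cube_norm n A (x : 'rV[R]_n) : ~ rV_cube A x -> A < `|x|.
Proof.
move/existsNP => [i]; rewrite /= in_itv/= -ler_norml => /negP; rewrite -ltNge.
by move=> /lt_le_trans; apply; exact: rV_coord_norm.
Qed.

Definition slab n (A : R) : set (R * 'rV[R]_n) :=
  `[- A, A]%classic `*` rV_cube A.

Lemma slab_compact n A : compact (@slab n A).
Proof. exact: compact_setX (@segment_compact _ _ _) (@rV_cube_compact n A). Qed.

Lemma slab_measurable n A : measurable (@slab n A).
Proof. by apply: compact_measurable_prod; exact: slab_compact. Qed.

Lemma slab_norm n A (z : R * 'rV[R]_n) : ~ slab A z -> A < `|z|.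
Proof.
rewrite prod_normE lt_max => /not_andP[|/rV_cube_norm ->]; last by rewrite orbT.
by rewrite /= in_itv/= -ler_norml => /negP; rewrite -ltNge => ->.
Qed.

Lemma slab_fin n A : 0 <= A ->
  ((@lebesgue_measure R \x lebesgue_rV n) (@slab n A) < +oo)%E.
Proof.
move=> A0; rewrite product_measure1E//; last exact: rV_cube_measurable.
rewrite [X in (X * _)%E](_ : _ = (A *+ 2)%:E); last exact: lebesgue_sym_segment.
rewrite [X in (_ * X)%E](_ : _ = ((A *+ 2) ^+ n)%:E) -?EFinM ?ltry//.
exact: lebesgue_rV_cube.
Qed.

Lemma integrable_prod n (F : R * 'rV[R]_n -> R) A : continuous F ->
  0 <= A -> (forall x, A < `|x| -> F x = 0) ->
  (@lebesgue_measure R \x lebesgue_rV n)%E.-integrable setT (EFin \o F).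
Proof.
move=> cF A0 F0; rewrite (_ : EFin \o F = (EFin \o F) \_ (slab A)).
  apply/(@integrable_mkcond _ _ _ (lebesgue_measure \x lebesgue_rV n)%E
    (slab A) (EFin \o F) (@slab_measurable n A)).
  apply: measurable_bounded_integrable.
  - exact: (@slab_measurable n A).
  - exact: (@slab_fin n A).
  - apply: measurable_funTS; exact: (continuous_measurable_prod cF).
  - exact: continuous_compact_bounded cF (@slab_compact n A).
apply/funext => x; rewrite patchE; case: ifPn => //= /negP.
by rewrite in_setE => /slab_norm/F0 ->.
Qed.

End compactly_supported_integral.

(** * The integral of a derivative of a compactly supported function *)

Section derivative_of_compact_support.
Context (R : realType).

(* Both sides are the limit of the same difference quotients. *)
Lemma derive_reparam (V W : normedModType R) (i : V -> W) (v : V) (w : W) x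
    (F : W -> R) : (forall h, i (h *: v + x) = h *: w + i x) ->
  (derivable F (i x) w -> derivable (F \o i) x v) *
  ('D_v (F \o i) x = 'D_w F (i x)).
Proof.
move=> iE; rewrite /derivable /derive.
rewrite (_ : (fun h => h^-1 *: (((F \o i) \o shift x) (h *: v) - (F \o i) x)) =
  (fun h => h^-1 *: ((F \o shift (i x)) (h *: w) - F (i x)))) //.
by apply/funext => h /=; rewrite iE.
Qed.

Lemma continuous_derive_reparam (V W : normedModType R) (i : V -> W) v w
    (F : W -> R) : (forall x h, i (h *: v + x) = h *: w + i x) ->
  continuous i -> continuous ('D_w F) -> continuous ('D_v (F \o i)).
Proof.
move=> iE ci cF; rewrite (_ : 'D_v (F \o i) = 'D_w F \o i).
  by move=> x; apply: continuous_comp; [exact: ci|exact: cF].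
by apply/funext => x; have [_ ->] := derive_reparam F (iE x).
Qed.

Lemma pairl_continuous (V W : topologicalType) (y : W) :
  continuous (fun x : V => (x, y)).
Proof. by move=> x; apply: cvg_pair; [exact: cvg_id|exact: cvg_cst]. Qed.

Lemma pairr_continuous (V W : topologicalType) (x : V) :
  continuous (fun y : W => (x, y)).
Proof. by move=> y; apply: cvg_pair; [exact: cvg_cst|exact: cvg_id]. Qed.

Lemma derive_far0 (V : normedModType R) (F : V -> R) A v :
  (forall x, A < `|x| -> F x = 0) -> forall x, A < `|x| -> 'D_v F x = 0.
Proof.
move=> F0 x Ax; rewrite (@near_eq_derive _ _ _ F (cst 0))//; first exact: derive_cst.
have : \near x, A < `|x|.
  have nx : `|y| @[y --> x] --> `|x| by exact: norm_continuous.
  by apply: (cvgr_gt _ nx).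
by apply: filterS => y /F0.
Qed.

Lemma integral_derive1_eq0 (f : R -> R) A :
  (forall x, derivable f x 1) -> continuous ('D_1 f) -> 0 <= A ->
  (forall x, A < `|x| -> f x = 0) ->
  (\int[lebesgue_measure]_x ('D_1 f x)%:E = 0)%E.
Proof.
move=> df cdf A0 f0.
have cf : continuous f.
  by move=> x; apply/differentiable_continuous/derivable1_diffP.
(* [f] is only known to vanish where [A < |x|], so the segment is widened by 1 to make both endpoint
   values zero. *)
rewrite (_ : (fun x => _) = (EFin \o 'D_1 f) \_ `[- (A + 1), A + 1]); last first.
  apply/funext => x; rewrite patchE; case: ifPn => //= /negP.
  rewrite in_setE/= in_itv/= -ler_norml => /negP; rewrite -ltNge => Ax.
  by rewrite (derive_far0 _ f0)//; lra.
rewrite -integral_mkcond (@continuous_FTC2 _ ('D_1 f) f)//.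
- by rewrite !f0 ?subee//; rewrite ?normrN ger0_norm; lra.
- lra.
- exact: continuous_subspaceT.
- split; first by [].
  + exact/cvg_at_right_filter/cf.
  + exact/cvg_at_left_filter/cf.
- by move=> x _; rewrite derive1E.
Qed.

(** Named because it is the induction hypothesis on the dimension: [integral_Dx_eq0] consumes it in
    dimension [n] to serve the step to [n.+1]. *)
Definition derive_integral_eq0 n := forall (F : 'rV[R]_n -> R) i A,
  (forall x, derivable F x (delta_mx ord0 i)) ->
  continuous ('D_(delta_mx ord0 i) F) -> 0 <= A ->
  (forall x, A < `|x| -> F x = 0) ->
  (\int[lebesgue_rV n]_x ('D_(delta_mx ord0 i) F x)%:E = 0)%E.

(** Fubini with time innermost: for each fixed [y] the inner integral is that of the derivative of a
    compactly supported function of one variable. *)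
Lemma integral_Dt_eq0 n (F : R * 'rV[R]_n -> R) A :
  (forall z, derivable F z ((1, 0) : R * 'rV[R]_n)) ->
  continuous (Dt F) -> 0 <= A -> (forall x, A < `|x| -> F x = 0) ->
  (\int[lebesgue_measure \x lebesgue_rV n]_z (Dt F z)%:E = 0)%E.
Proof.
move=> dF cF A0 F0.
have iF : (@lebesgue_measure R \x lebesgue_rV n)%E.-integrable setT
    (EFin \o Dt F).
  by apply: (integrable_prod cF A0) => x; exact: derive_far0.
etransitivity; first exact/esym/(integral21_prod_meas1 iF).
apply: integral0_eq => y _; rewrite /fubini_G /=.
have iE t h : (h *: 1 + t, y) = h *: (1, 0) + (t, y) :> R * 'rV[R]_n.
  by congr pair => /=; rewrite scaler0 add0r.
transitivity (\int[lebesgue_measure]_t ('D_1 (fun t => F (t, y)) t)%:E)%E.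
  apply: eq_integral => t _; congr EFin.
  by have [_ ->] := @derive_reparam R^o _ (fun t => (t, y)) 1 _ t F (iE t).
apply: (@integral_derive1_eq0 _ A) => //.
- move=> t.
  exact: (fst (@derive_reparam R^o _ (fun t => (t, y)) 1 _ t F (iE t)) (dF _)).
- exact: (@continuous_derive_reparam R^o _ (fun t => (t, y)) 1 _ F iE
    (@pairl_continuous _ _ y) cF).
- by move=> t At; apply: F0; rewrite prod_normE lt_max At.
Qed.

Lemma integral_Dx_eq0 n (F : R * 'rV[R]_n -> R) A i : derive_integral_eq0 n ->
  (forall z, derivable F z ((0, delta_mx ord0 i) : R * 'rV[R]_n)) ->
  continuous (Dx i F) -> 0 <= A -> (forall x, A < `|x| -> F x = 0) ->
  (\int[lebesgue_measure \x lebesgue_rV n]_z (Dx i F z)%:E = 0)%E.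
Proof.
move=> IH dF cF A0 F0.
have iF : (@lebesgue_measure R \x lebesgue_rV n)%E.-integrable setT
    (EFin \o Dx i F).
  by apply: (integrable_prod cF A0) => x; exact: derive_far0.
etransitivity; first exact/esym/(integral12_prod_meas1 iF).
apply: integral0_eq => t _; rewrite /fubini_F /=.
pose e := delta_mx ord0 i : 'rV[R]_n.
have iE y h : (t, h *: e + y) = h *: (0, e) + (t, y) :> R * 'rV[R]_n.
  by congr pair => /=; rewrite scaler0 add0r.
transitivity (\int[lebesgue_rV n]_y ('D_e (fun y => F (t, y)) y)%:E)%E.
  apply: eq_integral => y _; congr EFin.
  by have [_ ->] := @derive_reparam _ _ (fun y => (t, y)) e _ y F (iE y).
apply: (IH _ _ A) => //.
- move=> y.
  exact: (fst (@derive_reparam _ _ (fun y => (t, y)) e _ y F (iE y)) (dF _)).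
- exact: (@continuous_derive_reparam _ _ (fun y => (t, y)) e _ F iE
    (@pairr_continuous _ _ t) cF).
- by move=> y At; apply: F0; rewrite prod_normE lt_max At orbT.
Qed.

Lemma cons_rV_norm n (z : R * 'rV[R]_n) : `|z| <= `|cons_rV z|.
Proof.
rewrite prod_normE ge_max -{1}(cons_rV0 z) rV_coord_norm/=.
rewrite [leLHS]mx_normrE; apply: bigmax_le => // -[i j] _ /=.
by rewrite (ord1 i) -(ord1 ord0) -cons_rVS rV_coord_norm.
Qed.

Lemma cons_rV_affine n (h : R) (w z : R * 'rV[R]_n) :
  cons_rV (h *: w + z) = h *: cons_rV w + cons_rV z.
Proof.
apply/rowP => i; case: (unliftP ord0 i) => [j|] ->.
  by rewrite !mxE liftK/= !mxE.
by rewrite !mxE unlift_none.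
Qed.

(** The measure in dimension [n.+1] is the image of a product under [cons_rV], so a change of
    variables leads to the product. There the first basis vector becomes the time direction and the
    others become space directions in dimension [n]. *)
Lemma integral_derive_eq0 n : derive_integral_eq0 n.
Proof.
elim: n => [|n IH] F i A dF cF A0 F0; first by case: i dF cF.
pose e : 'rV[R]_n.+1 := delta_mx ord0 i.
pose w := uncons_rV e; pose G := F \o @cons_rV R n.
pose DF : 'rV[R]_n.+1 -> R := fun x => 'D_e F x.
pose DG : R * 'rV[R]_n -> R := fun z => 'D_w G z.
have iE z h : cons_rV (h *: w + z) = h *: e + cons_rV z.
  by rewrite cons_rV_affine cons_unconsK.
have cG : continuous ('D_w G).
  exact: (@continuous_derive_reparam _ _ _ w e F iE (@cons_rV_continuous R n) cF).
have dG z : derivable G z w by exact: (fst (derive_reparam F (iE z)) (dF _)).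
have G0 z : A < `|z| -> G z = 0.
  by move=> /lt_le_trans Az; apply: F0; apply: Az; exact: cons_rV_norm.
have GE z : DF (cons_rV z) = DG z.
  exact/esym/(snd (derive_reparam F (iE z))).
have iG : (@lebesgue_measure R \x lebesgue_rV n)%E.-integrable setT
    (EFin \o DG).
  by apply: (integrable_prod cG A0) => x; exact: derive_far0.
have GE' : (fun x => (DF x)%:E) \o @cons_rV R n = EFin \o DG.
  by apply/funext => z /=; rewrite GE.
have mF : measurable_fun [set: 'rV[R]_n.+1] (fun x => (DF x)%:E).
  by apply/measurable_EFinP; exact: (continuous_measurable_rV cF).
have iG' : (@lebesgue_measure R \x lebesgue_rV n)%E.-integrable
    (@cons_rV R n @^-1` setT) ((fun x => (DF x)%:E) \o @cons_rV R n).
  by rewrite GE'.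
have mc : measurable_fun [set: measurableTypeR R * 'rV[R]_n] (@cons_rV R n).
  exact: (@measurable_cons_rV R n).
have pE := integral_pushforward mc mF iG' measurableT.
transitivity (\int[lebesgue_measure \x lebesgue_rV n]_(z in
    @cons_rV R n @^-1` setT) ((fun x => (DF x)%:E) \o @cons_rV R n) z)%E.
  exact: pE.
rewrite preimage_setT GE'.
move: dG cG {GE GE' iE iG mF iG' pE}; rewrite /DG /w /e.
case: (unliftP ord0 i) => [j|] ->.
  rewrite (_ : uncons_rV _ = (0, delta_mx ord0 j)).
    by move=> dG cG; exact: (@integral_Dx_eq0 _ _ A).
  congr pair; first by rewrite mxE.
  apply/rowP => l; rewrite !mxE/=.
  by rewrite (inj_eq lift_inj).
rewrite (_ : uncons_rV _ = (1, 0)).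
  by move=> dG cG; exact: (@integral_Dt_eq0 _ _ A).
congr pair; first by rewrite mxE !eqxx.
by apply/rowP => l; rewrite !mxE.
Qed.

End derivative_of_compact_support.

(** * C^n functions and the truncated polynomial bump *)

Section class_C_calculus.
Context (R : realType) (V : normedModType R).
Implicit Types (f g : V -> R) (n : nat).

Lemma class_C_continuous n f : class_C n f -> continuous f.
Proof. by case: n => [|n] []. Qed.

Lemma class_C_derivable n f v z : class_C n.+1 f -> derivable f z v.
Proof. by case=> _ /(_ v)[]. Qed.

Arguments class_C_derivable {n f} v z _.

Lemma class_C_derive n f v : class_C n.+1 f -> class_C n ('D_v f).
Proof. by case=> _ /(_ v)[]. Qed.

Lemma class_CS n f : class_C n.+1 f -> class_C n f.
Proof.
elim: n f => [|n IH] f [cf Df]; first by split.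
split=> // v; have [df Cf] := Df v; split=> //; exact: IH.
Qed.

Lemma class_C_cst n (c : R) : class_C n (fun _ : V => c).
Proof.
elim: n c => [|n IH] c; split=> //; try by move=> x; exact: cvg_cst.
move=> v; split; first by move=> z; exact: derivable_cst.
rewrite (_ : 'D_v _ = fun=> 0); first exact: IH.
by apply/funext => z; exact: derive_cst.
Qed.

Lemma class_CD n f g : class_C n f -> class_C n g ->
  class_C n (fun z => f z + g z).
Proof.
elim: n f g => [|n IH] f g [cf Df] [cg Dg]; split=> //;
  try by move=> x; apply: cvgD; [exact: cf|exact: cg].
move=> v; have [df Cf] := Df v; have [dg Cg] := Dg v; split.
  by move=> z; exact: derivableD.
rewrite (_ : 'D_v _ = fun z => 'D_v f z + 'D_v g z); first exact: IH.
by apply/funext => z; exact: deriveD.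
Qed.

Lemma class_CM n f g : class_C n f -> class_C n g ->
  class_C n (fun z => f z * g z).
Proof.
elim: n f g => [|n IH] f g Cf Cg; have cf := class_C_continuous Cf;
  have cg := class_C_continuous Cg; split=> //;
  try by move=> x; apply: cvgM; [exact: cf|exact: cg].
move=> v; split.
  move=> z; have df := class_C_derivable v z Cf.
  by have dg := class_C_derivable v z Cg; exact (derivableM df dg).
rewrite (_ : 'D_v _ = fun z => f z * 'D_v g z + g z * 'D_v f z).
  by apply: class_CD; apply: IH; (exact: class_CS || exact: class_C_derive).
apply/funext => z; have df := class_C_derivable v z Cf.
by have dg := class_C_derivable v z Cg; exact (deriveM df dg).
Qed.

Lemma class_C_sum n (I : Type) (r : seq I) (F : I -> V -> R) :
  (forall i, class_C n (F i)) -> class_C n (fun z => \sum_(i <- r) F i z).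
Proof.
move=> CF; elim: r => [|i r IH].
  under eq_fun do rewrite big_nil; exact: class_C_cst.
by under eq_fun do rewrite big_cons; exact: class_CD.
Qed.

Lemma class_C_prod n (I : Type) (r : seq I) (P : pred I) (F : I -> V -> R) :
  (forall i, class_C n (F i)) ->
  class_C n (fun z => \prod_(i <- r | P i) F i z).
Proof.
move=> CF; elim: r => [|i r IH].
  under eq_fun do rewrite big_nil; exact: class_C_cst.
under eq_fun do rewrite big_cons; case: (P i); last exact: IH.
exact: class_CM.
Qed.

Lemma is_derive_invariant f v z :
  (forall h, f (h *: v + z) = f z) -> is_derive z v f 0.
Proof.
move=> fE; have : h^-1 *: ((f \o shift z) (h *: v) - f z) @[h --> 0^'] --> (0 : R).
  rewrite (_ : (fun h => _) = cst 0); first exact: cvg_cst.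
  by apply/funext => h /=; rewrite fE subrr scaler0.
by move=> f0; apply: DeriveDef; [apply/cvg_ex; exists 0|exact: cvg_lim].
Qed.

End class_C_calculus.
Arguments class_C_derivable {R V n f} v z _.

(** The derivative of [f \o i] along [v] is the derivative of [f] along [w v], again composed with
    [i]; the induction closes on the same shape. *)
Lemma class_C_comp_affine (R : realType) (V W : normedModType R) n
    (i : V -> W) (w : V -> W) (f : W -> R) :
  (forall v x h, i (h *: v + x) = h *: w v + i x) -> continuous i ->
  class_C n f -> class_C n (f \o i).
Proof.
move=> iE ci; elim: n f => [|n IH] f [cf Df]; split=> //;
  try by move=> x; apply: continuous_comp; [exact: ci|exact: cf].
move=> v; have [df Cf] := Df (w v); split.
  by move=> z; exact: (fst (derive_reparam f (iE v z)) (df _)).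
rewrite (_ : 'D_v _ = 'D_(w v) f \o i); first exact: IH.
by apply/funext => z; exact: (snd (derive_reparam f (iE v z))).
Qed.

Section bump.
Context (R : realType).

Lemma is_derive_dir (f : R -> R) (y v d : R) :
  is_derive y (1 : R) f d -> is_derive y v f (v * d).
Proof.
move=> [df fd]; have diff : differentiable f y by exact/derivable1_diffP.
apply: DeriveDef; first exact: diff_derivable.
by rewrite -fd !deriveE// -[v in LHS]mulr1 -[v * 1]/(v *: 1) linearZ.
Qed.

Definition ppow n (y : R) := Num.max y 0 ^+ n.

(** The kink at 0 is harmless for the square: the first-order Taylor remainder is at most [h^2], on
    either side of 0 and across it. *)
Lemma is_derive_ppow2 (y : R) : is_derive y (1 : R) (ppow 2) (Num.max y 0 *+ 2).
Proof.
have : h^-1 *: ((ppow 2 \o shift y) (h *: 1) - ppow 2 y) @[h --> 0^'] -->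
    (Num.max y 0 *+ 2 : R).
  apply/cvgrPdist_le => /= e e0; near=> h.
  have h0 : h != 0 by near: h; exact: nbhs_dnbhs_neq.
  have he : `|h| <= e.
    near: h; apply: dnbhs0_le => //.
  apply: le_trans he.
  rewrite -(ler_pM2l (_ : 0 < `|h|)) ?normr_gt0// -normrM mulrBr /ppow.
  rewrite [h%:A]mulr1 [_ *: _]/(h^-1 * _) mulVKf// -normrM.
  rewrite -expr2 [leRHS]ger0_norm ?sqr_ge0// ler_norml /Num.max.
  by case: ltP => y0; case: ltP => yh0; apply/andP; split; nra.
move=> f0; apply: DeriveDef; last exact: cvg_lim.
by apply/cvg_ex; eexists; exact: f0.
Unshelve. all: by end_near. Qed.

(** One degree lower this fails, since [y * ppow 0 y] is [y] and not its positive part; hence the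
    product-rule induction for derivatives starts at the square. *)
Lemma ppowS n y : ppow n.+2 y = y * ppow n.+1 y.
Proof.
by rewrite /ppow [LHS]exprS; case: leP => //; rewrite !expr0n/= !mulr0.
Qed.

Lemma is_derive_ppow n (y : R) :
  is_derive y (1 : R) (ppow n.+2) (ppow n.+1 y *+ n.+2).
Proof.
elim: n => [|n IH]; first exact: is_derive_ppow2.
rewrite (_ : ppow n.+3 = id * ppow n.+2); last first.
  by apply/funext => z; rewrite ppowS.
apply: is_derive_eq; rewrite /= -[_ *: _]/(_ * _) -[_ *: 1]/(_ * 1) mulr1.
by rewrite mulrnAr -ppowS -mulrSr.
Qed.

Lemma class_C_ppow n : class_C n (ppow n.+1 : R^o -> R).
Proof.
elim: n => [|n IH]; split=> //.
- move=> y; rewrite /ppow; under eq_fun do rewrite expr1.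
  by apply: continuous_max; [exact: cvg_id|exact: cvg_cst].
- move=> y; apply: differentiable_continuous; apply/derivable1_diffP.
  by have [] := is_derive_ppow n y.
- move=> v; split.
    by move=> y; have [] := is_derive_dir v (is_derive_ppow n y).
  rewrite (_ : 'D_v _ = fun y => v *+ n.+2 * ppow n.+1 y).
    by apply: class_CM => //; exact: class_C_cst.
  apply/funext => y; have [_ ->] := is_derive_dir v (is_derive_ppow n y).
  by rewrite mulrnAr mulrnAl.
Qed.

Lemma is_derive_reparam (V W : normedModType R) (i : V -> W) v w x
    (F : W -> R) d : (forall h, i (h *: v + x) = h *: w + i x) ->
  is_derive (i x) w F d -> is_derive x v (F \o i) d.
Proof.
move=> iE [dF <-]; have [dFi DFi] := derive_reparam F iE.
by apply: DeriveDef; [exact: dFi|exact: DFi].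
Qed.

(* [bump l s] is [(1 - s^2)^l] for [|s| <= 1] and [0] otherwise; with this
   factorization it is a product of [ppow] composed with affine maps. *)
Definition bump l (s : R) := ppow l (1 - s) * ppow l (1 + s).

(** [bump1 l] is the derivative of [bump l.+2], and [bump2 l] the second derivative of [bump l.+3];
    the shifted indices avoid subtraction in exponents. *)
Definition bump1 l (s : R) := l.+2%:R *
  (ppow l.+2 (1 - s) * ppow l.+1 (1 + s) -
   ppow l.+1 (1 - s) * ppow l.+2 (1 + s)).

Definition bump2 l (s : R) := l.+3%:R *
  (l.+2%:R * (ppow l.+1 (1 - s) * ppow l.+3 (1 + s) +
              ppow l.+3 (1 - s) * ppow l.+1 (1 + s)) -
   l.+3%:R *+ 2 * (ppow l.+2 (1 - s) * ppow l.+2 (1 + s))).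

Lemma is_derive_ppowD n (c s : R) :
  is_derive s (1 : R) (fun s => ppow n.+2 (c + s)) (n.+2%:R * ppow n.+1 (c + s)).
Proof.
apply: (@is_derive_reparam R^o R^o (fun s => c + s) 1 1) => [h|].
  by rewrite addrCA.
by rewrite mulr_natl; exact: is_derive_ppow.
Qed.

Lemma is_derive_ppowB n (c s : R) :
  is_derive s (1 : R) (fun s => ppow n.+2 (c - s))
    (- (n.+2%:R * ppow n.+1 (c - s))).
Proof.
apply: (@is_derive_reparam R^o R^o (fun s => c - s) 1 (-1)) => [h|].
  by rewrite opprD scalerN addrCA.
apply: is_derive_eq (is_derive_dir (-1) (is_derive_ppow n (c - s))) _.
by rewrite mulN1r mulr_natl.
Qed.

Lemma is_derive_bump l (s : R) : is_derive s (1 : R) (bump l.+2) (bump1 l s).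
Proof.
have dB := is_derive_ppowB l 1 s; have dD := is_derive_ppowD l 1 s.
apply: is_derive_eq (is_deriveM dB dD) _.
rewrite -[_ *: _]/(_ * _) -[X in _ + X]/(_ * _) /bump1; ring.
Qed.

Lemma is_derive_bump1 l (s : R) : is_derive s (1 : R) (bump1 l.+1) (bump2 l s).
Proof.
have dB := is_derive_ppowB l.+1 1 s; have dD := is_derive_ppowD l.+1 1 s.
have dB' := is_derive_ppowB l 1 s; have dD' := is_derive_ppowD l 1 s.
have d1 := is_deriveM dB dD'; have d2 := is_deriveM dB' dD.
have d3 := is_deriveZ l.+3%:R (is_deriveB d1 d2).
apply: is_derive_eq d3 _.
rewrite /GRing.scale/= /bump2; ring.
Qed.

(** The positive part of [1 - s^2]. The derivatives of the bump are bounded by its powers, which is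
    the form that [young_absorb] takes. *)
Definition bumpw (s : R) := Num.max (1 - s) 0 * Num.max (1 + s) 0.

Lemma bumpE l s : bump l s = bumpw s ^+ l.
Proof. by rewrite /bump /ppow -exprMn. Qed.

Lemma bumpw_ge0 s : 0 <= bumpw s.
Proof. by rewrite mulr_ge0// le_max lexx orbT. Qed.

Lemma bumpw_le1 s : bumpw s <= 1.
Proof.
by rewrite /bumpw /Num.max; case: ltP => ?; case: ltP => ?; nra.
Qed.

Lemma bumpw_out s : 1 <= `|s| -> bumpw s = 0.
Proof.
rewrite ler_normr /bumpw /Num.max => /orP[] ?; case: ltP => ?; case: ltP => ?; nra.
Qed.

Lemma bumpw_in s : `|s| <= 2^-1 -> 3 / 4 <= bumpw s.
Proof.
rewrite ler_norml /bumpw /Num.max => /andP[? ?].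
by case: ltP => ?; case: ltP => ?; nra.
Qed.

Lemma bumpw_neq0 s : bumpw s != 0 -> `|s| < 1.
Proof. by apply: contraR; rewrite -leNgt => /bumpw_out ->. Qed.

(** Where [bumpw s] is nonzero, [|s| < 1] and the positive parts disappear; the derivative is then
    [l.+2] times [(1 - s^2)^(l+1)] times [-2s]. *)
Lemma bump1_le l s : `|bump1 l s| <= l.+2%:R *+ 2 * bumpw s ^+ l.+1.
Proof.
have [w0|/bumpw_neq0] := eqVneq (bumpw s) 0.
  rewrite w0 expr0n/= mulr0 normr_le0 /bump1 /ppow.
  move: w0; rewrite /bumpw => /eqP; rewrite mulf_eq0 => /orP[] /eqP ->;
    by rewrite !expr0n/= ?mulr0 ?mul0r subrr mulr0.
rewrite ltr_norml => /andP[s0 s1].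
have a0 : 0 < 1 - s by lra.
have c0 : 0 < 1 + s by lra.
rewrite /bump1 /bumpw /ppow !(max_l (ltW _))//.
rewrite (_ : _ - _ = ((1 - s) * (1 + s)) ^+ l.+1 * (- (s *+ 2))); last first.
  by rewrite exprMn !(exprS _ l.+1); ring.
rewrite normrM normrM (ger0_norm (ler0n _ _)) ger0_norm; last first.
  by rewrite exprn_ge0// mulr_ge0// ltW.
rewrite -[X in _ <= X * _]mulr_natr -mulrA ler_wpM2l// mulrC ler_wpM2r//.
  by rewrite exprn_ge0// mulr_ge0// ltW.
by rewrite normrN ler_norml; apply/andP; split; lra.
Qed.

(** With [(1 - s^2)^(l+1)] and [l.+3] factored out, [4 L s^2 - 2 + 2 s^2] remains, where
    [L = l + 2]; on [|s| < 1] the bound [10 (L + 1)] is generous. *)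
Lemma bump2_le l s : `|bump2 l s| <= 10 * l.+3%:R ^+ 2 * bumpw s ^+ l.+1.
Proof.
have [w0|/bumpw_neq0] := eqVneq (bumpw s) 0.
  rewrite w0 expr0n/= mulr0 normr_le0 /bump2 /ppow.
  move: w0; rewrite /bumpw => /eqP; rewrite mulf_eq0 => /orP[] /eqP ->;
    by rewrite !expr0n/= ?mulr0 ?mul0r ?addr0 ?mulr0 subrr mulr0.
rewrite ltr_norml => /andP[s0 s1].
have a0 : 0 < 1 - s by lra.
have c0 : 0 < 1 + s by lra.
have w0 : 0 <= ((1 - s) * (1 + s)) ^+ l.+1 by rewrite exprn_ge0// mulr_ge0// ltW.
rewrite /bump2 /bumpw /ppow !(max_l (ltW _))//.
rewrite (_ : l.+2%:R * _ - _ = ((1 - s) * (1 + s)) ^+ l.+1 *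
   (l.+2%:R * ((1 - s) ^+ 2 + (1 + s) ^+ 2) -
    l.+3%:R *+ 2 * ((1 - s) * (1 + s)))); last first.
  by rewrite exprMn !(exprS _ l.+2) !(exprS _ l.+1); ring.
rewrite mulrCA normrM (ger0_norm w0) [leRHS]mulrC ler_wpM2l// normrM.
rewrite (ger0_norm (ler0n _ _)) expr2 [leRHS]mulrCA ler_wpM2l//.
rewrite [l.+3%:R]mulrSr; set L := l.+2%:R; have L0 : 0 <= L by exact: ler0n.
have q1 : s ^+ 2 <= 1 by nra.
have Lq0 : 0 <= L * s ^+ 2 by rewrite mulr_ge0// sqr_ge0.
have Lq1 : L * s ^+ 2 <= L by rewrite ler_piMr.
rewrite (_ : _ - _ = 4 * (L * s ^+ 2) - 2 + 2 * s ^+ 2); last by ring.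
by have := sqr_ge0 s; rewrite ler_norml => q0; apply/andP; split; lra.
Qed.

Lemma class_CW (V : normedModType R) m n (f : V -> R) : (m <= n)%N ->
  class_C n f -> class_C m f.
Proof.
elim: n => [|n IH]; first by rewrite leqn0 => /eqP ->.
by rewrite leq_eqVlt => /predU1P[->//|mn /class_CS]; exact: IH.
Qed.

Lemma class_C_bump l n : (n < l)%N -> class_C n (bump l : R^o -> R).
Proof.
case: l => // l; rewrite ltnS => nl; apply: (class_CW nl).
apply: class_CM.
- apply: (@class_C_comp_affine _ R^o R^o _ (fun s => 1 - s) (fun v => - v)).
  + by move=> v x h; rewrite opprD scalerN addrCA.
  + by move=> x; apply: cvgB; [exact: cvg_cst|exact: cvg_id].
  + exact: class_C_ppow.
- apply: (@class_C_comp_affine _ R^o R^o _ (fun s => 1 + s) (fun v => v)).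
  + by move=> v x h; rewrite addrCA.
  + by move=> x; apply: cvgD; [exact: cvg_cst|exact: cvg_id].
  + exact: class_C_ppow.
Qed.

End bump.

(** * Local integrability of continuous functions, and supports of test functions *)

Section local_integrability.
Context (R : realType) (n : nat).

Lemma bounded_subset_cube (K : set 'rV[R]_n) : compact K ->
  exists2 A, 0 <= A & K `<=` rV_cube A.
Proof.
move=> /compact_bounded[M [Mr KM]]; exists (Num.max M 0 + 1).
  by rewrite addr_ge0// le_max lexx orbT.
move=> x Kx i; rewrite /= in_itv/= -ler_norml.
apply: le_trans (rV_coord_norm x i) _; apply: KM => //.
by rewrite (@le_lt_trans _ _ (Num.max M 0)) ?ltrDl// le_max lexx.
Qed.

Lemma bounded_subset_slab (K : set (R * 'rV[R]_n)) : compact K ->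
  exists2 A, 0 <= A & K `<=` slab A.
Proof.
move=> /compact_bounded[M [Mr KM]]; exists (Num.max M 0 + 1).
  by rewrite addr_ge0// le_max lexx orbT.
have H z : K z -> `|z| <= Num.max M 0 + 1.
  move=> Kz; apply: KM => //.
  by rewrite (@le_lt_trans _ _ (Num.max M 0)) ?ltrDl// le_max lexx.
move=> z /H; rewrite prod_normE ge_max => /andP[z1 z2]; split.
  by rewrite /= in_itv/= -ler_norml.
by move=> i; rewrite /= in_itv/= -ler_norml (le_trans (rV_coord_norm _ i)).
Qed.

Lemma continuous_compact_integral_rV (f : 'rV[R]_n -> R) K : continuous f ->
  compact K -> (\int[lebesgue_rV n]_(x in K) `|f x|%:E < +oo)%E.
Proof.
move=> cf cK; have [A A0 KA] := bounded_subset_cube cK.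
have mK := compact_measurable_rV cK.
suff /integrableP[] : (lebesgue_rV n).-integrable K (EFin \o f) by [].
apply: measurable_bounded_integrable => //.
- apply: le_lt_trans (rV_cube_fin n A0).
  by apply: le_measure => //; rewrite inE//; exact: rV_cube_measurable.
- apply: measurable_funTS; exact: (continuous_measurable_rV cf).
- exact: continuous_compact_bounded cf cK.
Qed.

Lemma continuous_compact_integral_prod (f : R * 'rV[R]_n -> R) K :
  continuous f -> compact K ->
  (\int[lebesgue_measure \x lebesgue_rV n]_(z in K) `|f z|%:E < +oo)%E.
Proof.
move=> cf cK; have [A A0 KA] := bounded_subset_slab cK.
have mK := compact_measurable_prod cK.
suff /integrableP[] : (@lebesgue_measure R \x lebesgue_rV n)%E.-integrable
    K (EFin \o f) by [].
apply: measurable_bounded_integrable => //.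
- apply: le_lt_trans (slab_fin n A0).
  by apply: le_measure => //; rewrite inE//; exact: slab_measurable.
- apply: measurable_funTS; exact: (continuous_measurable_prod cf).
- exact: continuous_compact_bounded cf cK.
Qed.

End local_integrability.

Section vanishing.
Context (R : realType).

Lemma support_of_out (V : topologicalType) (f : V -> R) z :
  ~ support_of f z -> f z = 0.
Proof.
by move=> fz; apply/eqP/negPn/negP => fz0; apply: fz; exact: subset_closure.
Qed.

(** The complement of the support is open, so near each of its points [f] agrees with the zero
    function and has zero derivative. *)
Lemma support_of_derive (V : normedModType R) (f : V -> R) v :
  support_of ('D_v f) `<=` support_of f.
Proof.
rewrite {2}/support_of (closure_id (closure _)).1; last exact: closed_closure.
apply: closure_subset => z /= Df0; apply: contrapT => fz; move/eqP : Df0; apply.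
rewrite (@near_eq_derive _ _ _ f (cst 0)); first exact: derive_cst.
have : open (~` support_of f) by apply: closed_openC; exact: closed_closure.
rewrite openE => /(_ _ fz); apply: filterS => y; exact: support_of_out.
Qed.

Lemma test_function_bounded (n : nat) (V : normedModType R) (Om : set V) f :
  test_function n Om f ->
  exists2 A, 0 <= A & forall z, A < `|z| -> ~ support_of f z.
Proof.
move=> [_ /compact_bounded[M [Mr KM]] _]; exists (Num.max M 0 + 1).
  by rewrite addr_ge0// le_max lexx orbT.
move=> z; rewrite ltNge => /negP zA fz; apply: zA; apply: KM => //.
by rewrite (@le_lt_trans _ _ (Num.max M 0)) ?ltrDl// le_max lexx.
Qed.

End vanishing.

(** * Integration by parts against test functions *)

Section integration_by_parts.
Context (R : realType) (N : nat).
Local Notation mu := (@lebesgue_measure R \x lebesgue_rV N)%E.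
Implicit Types F G : R * 'rV[R]_N -> R.

Lemma Rintegral_halfspace F : (forall z, ~ halfspace z -> F z = 0) ->
  \int[mu]_(z in halfspace) F z = \int[mu]_z F z.
Proof.
move=> F0; rewrite Rintegral_mkcond; congr Rintegral; apply/funext => z.
by rewrite patchE; case: ifPn => // /negP; rewrite in_setE => /F0 ->.
Qed.

(** Compact support is expressed by an explicit radius: sums then only need a maximum of radii, and
    the lemmas on integrals of derivatives take this form. *)
Definition Cc F := continuous F /\
  exists2 A, 0 <= A & forall z, A < `|z| -> F z = 0.

Lemma Cc_integrable F : Cc F -> mu.-integrable setT (EFin \o F).
Proof. by move=> [cF [A A0 F0]]; exact: integrable_prod F0. Qed.

Lemma CcD F G : Cc F -> Cc G -> Cc (fun z => F z + G z).
Proof.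
move=> [cF [A A0 FA]] [cG [B B0 GB]]; split.
  by move=> z; apply: cvgD; [exact: cF|exact: cG].
exists (Num.max A B); first by rewrite le_max A0.
by move=> z; rewrite gt_max => /andP[/FA -> /GB ->]; rewrite addr0.
Qed.

Lemma Cc_sum (I : Type) (r : seq I) (F : I -> R * 'rV[R]_N -> R) :
  (forall i, Cc (F i)) -> Cc (fun z => \sum_(i <- r) F i z).
Proof.
move=> cF; elim: r => [|i r IH].
  under eq_fun do rewrite big_nil; split; first by move=> z; exact: cvg_cst.
  by exists 0.
by under eq_fun do rewrite big_cons; exact: CcD.
Qed.

Lemma Rintegral_Cc_sum (I : Type) (r : seq I) (F : I -> R * 'rV[R]_N -> R) :
  (forall i, Cc (F i)) ->
  \int[mu]_z (\sum_(i <- r) F i z) = \sum_(i <- r) \int[mu]_z F i z.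
Proof.
move=> cF; elim: r => [|i r IH].
  rewrite big_nil; under eq_Rintegral do rewrite big_nil.
  by rewrite /Rintegral integral0.
rewrite big_cons -IH; under eq_Rintegral do rewrite big_cons.
rewrite RintegralD//; first exact: Cc_integrable.
exact/Cc_integrable/Cc_sum.
Qed.

Lemma Rintegral_Dt_eq0 F : (forall z, derivable F z ((1, 0) : R * 'rV[R]_N)) ->
  Cc F -> continuous (Dt F) -> \int[mu]_z Dt F z = 0.
Proof.
by move=> dF [_ [A A0 FA]] cDF; rewrite /Rintegral (integral_Dt_eq0 dF cDF A0 FA).
Qed.

Lemma Rintegral_Dx_eq0 i F :
  (forall z, derivable F z ((0, delta_mx ord0 i) : R * 'rV[R]_N)) ->
  Cc F -> continuous (Dx i F) -> \int[mu]_z Dx i F z = 0.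
Proof.
move=> dF [_ [A A0 FA]] cDF; rewrite /Rintegral.
by rewrite (integral_Dx_eq0 (@integral_derive_eq0 R N) dF cDF A0 FA).
Qed.

(* The integrand [u_ii phi - u Dx i (Dx i phi)] is the [i]-th derivative of
   [u_i phi - u Dx i phi]. *)
Lemma green_identity i (u ui uii phi : R * 'rV[R]_N -> R) :
  let e := (0, delta_mx ord0 i) : R * 'rV[R]_N in
  continuous u -> continuous ui -> continuous uii ->
  (forall z, is_derive z e u (ui z)) -> (forall z, is_derive z e ui (uii z)) ->
  test_function 2 halfspace phi ->
  [/\ Cc (fun z => uii z * phi z), Cc (fun z => u z * Dx i (Dx i phi) z) &
  \int[mu]_z (uii z * phi z) = \int[mu]_z (u z * Dx i (Dx i phi) z)].
Proof.
move=> e cu cui cuii du dui tphi; have [Cphi _ _] := tphi.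
have [A A0 phiA] := test_function_bounded tphi.
have C1 := class_C_derive e Cphi; have C0 := class_C_derive e C1.
have cphi := class_C_continuous Cphi.
have c1 := class_C_continuous C1; have c0 := class_C_continuous C0.
have cc1 : Cc (fun z => uii z * phi z).
  split; first by move=> z; apply: cvgM; [exact: cuii|exact: cphi].
  by exists A => // z /phiA/support_of_out ->; rewrite mulr0.
have cc2 : Cc (fun z => u z * Dx i (Dx i phi) z).
  split; first by move=> z; apply: cvgM; [exact: cu|exact: c0].
  exists A => // z /phiA phiz.
  rewrite (_ : Dx i _ z = 0) ?mulr0//; apply: support_of_out.
  by move=> /support_of_derive/support_of_derive.
split=> //; pose F z := ui z * phi z - u z * Dx i phi z.
have dF z : is_derive z e F (uii z * phi z - u z * Dx i (Dx i phi) z).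
  have dphi := derivableP (class_C_derivable e z Cphi).
  have d1 := derivableP (class_C_derivable e z C1).
  apply: is_derive_eq (is_deriveB (is_deriveM (dui z) dphi)
    (is_deriveM (du z) d1)) _.
  by rewrite /GRing.scale/= /Dx -/e; ring.
have DF : Dx i F = fun z => uii z * phi z - u z * Dx i (Dx i phi) z.
  by apply/funext => z; rewrite /Dx -/e; have [_ ->] := dF z.
have FCc : Cc F.
  split.
    move=> z; apply: cvgB; apply: cvgM.
    + exact: cui.
    + exact: cphi.
    + exact: cu.
    + exact: c1.
  exists A => // z /phiA phiz; rewrite /F (support_of_out phiz) mulr0.
  rewrite (_ : Dx i _ z = 0) ?mulr0 ?subrr//; apply: support_of_out.
  by move=> /support_of_derive.
have cDF : continuous (Dx i F).
  by rewrite DF => z; apply: cvgB; [exact: (proj1 cc1)|exact: (proj1 cc2)].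
have dF' z : derivable F z e by have [] := dF z.
apply/eqP; rewrite -subr_eq0 -RintegralB//; [|exact: Cc_integrable..].
by have := Rintegral_Dx_eq0 dF' FCc cDF; rewrite DF => ->.
Qed.

End integration_by_parts.

(** * Powers of 1 + |x|^2 and the stationary solution *)

Section stationary_profile.
Context (R : realType) (N : nat).
Implicit Types (x : 'rV[R]_N) (z : R * 'rV[R]_N) (b : R).

(** The square of the Japanese bracket, with the Euclidean norm; the library norm of a row vector is
    the sup norm, which is not smooth. *)
Definition japanese2 x : R := 1 + \sum_(i < N) x ord0 i ^+ 2.

Lemma japanese2_ge1 x : 1 <= japanese2 x.
Proof. by rewrite lerDl sumr_ge0// => i _; exact: sqr_ge0. Qed.

Lemma japanese2_gt0 x : 0 < japanese2 x.
Proof. exact: lt_le_trans (japanese2_ge1 x). Qed.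

Lemma is_derive_quadratic (V : normedModType R) (f : V -> R)
    (v z : V) (a b : R) :
  (forall h, f (h *: v + z) = f z + h * a + h ^+ 2 * b) -> is_derive z v f a.
Proof.
move=> fE; have : h^-1 *: ((f \o shift z) (h *: v) - f z) @[h --> 0^'] --> a.
  apply: (@cvg_trans _ ((a + h * b) @[h --> 0^'])).
    apply: near_eq_cvg; near=> h.
    have h0 : h != 0 by near: h; exact: nbhs_dnbhs_neq.
    by rewrite /= fE -[_ *: _]/(_ * _); field.
  have : a + h * b @[h --> 0^'] --> a + 0 * b.
    apply: cvgD; first exact: cvg_cst.
    by apply: cvgM; [exact: nbhs_dnbhs|exact: cvg_cst].
  by rewrite mul0r addr0.
by move=> f0; apply: DeriveDef; [apply/cvg_ex; exists a|exact: cvg_lim].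
Unshelve. all: by end_near. Qed.

(** [g] is only assumed to have a derivative along [v], so everything is restricted to the line
    through [z] directed by [v], where the one-variable chain rule applies. *)
Lemma is_derive_comp_dir (V : normedModType R) (f : R -> R) (g : V -> R)
    (v z : V) df dg :
  is_derive z v g dg -> is_derive (g z) (1 : R) f df ->
  is_derive z v (f \o g) (df * dg).
Proof.
move=> [dgz gE] fz; pose l (h : R^o) := h *: v + z.
have l0 : l 0 = z by rewrite /l scale0r add0r.
have lE h : l (h *: 1 + 0) = h *: v + l 0.
  by rewrite l0 /l addr0 -[h *: 1]/(h * 1) mulr1.
have cE : is_derive (0 : R^o) (1 : R^o) (g \o l) dg.
  have [dgl DE] := derive_reparam g lE.
  by apply: DeriveDef; [apply: dgl; rewrite l0|rewrite DE l0].
have fz' : is_derive ((g \o l) 0) (1 : R) f df by rewrite /= l0.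
have [dc <-] := is_derive1_comp fz' cE.
have [_ DE] := derive_reparam (f \o g) lE.
apply: DeriveDef; last by rewrite -{1}l0 -DE.
exact (proj2 (@derivable1P _ _ _ (f \o g) z v) dc).
Qed.

Let e (i : 'I_N) : R * 'rV[R]_N := (0, delta_mx ord0 i).

Lemma coord_line i h z j : (h *: e i + z).2 ord0 j = z.2 ord0 j + h * (j == i)%:R.
Proof. by rewrite /= !mxE eqxx/= addrC. Qed.

Lemma is_derive_coord i z :
  is_derive z (e i) (fun z => z.2 ord0 i) (1 : R).
Proof.
apply: (@is_derive_quadratic _ _ _ _ _ 0) => h.
by rewrite coord_line eqxx mulr0 addr0.
Qed.

Lemma is_derive_japanese2 i z :
  is_derive z (e i) (fun z => japanese2 z.2) (z.2 ord0 i *+ 2).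
Proof.
apply: (@is_derive_quadratic _ _ _ _ _ 1) => h.
rewrite /japanese2 (bigD1 i)//= [in RHS](bigD1 i)//= coord_line eqxx.
rewrite [true%:R]/(1 : R) mulr1.
under eq_bigr => j /negPf ji do rewrite coord_line ji mulr0 addr0.
by ring.
Qed.

Lemma is_derive_powR (y b : R) : 0 < y ->
  is_derive y (1 : R) (fun y => y `^ b) (b * y `^ (b - 1)).
Proof.
move=> y0; have yI : y \in `]0, +oo[ by rewrite in_itv/= y0.
by apply: DeriveDef; [exact: derivable_powR|rewrite -derive1E powR_derive1].
Qed.

Definition jpow b z : R := japanese2 z.2 `^ b.

Lemma is_derive_jpow b i z :
  is_derive z (e i) (jpow b) (b * 2 * (z.2 ord0 i * jpow (b - 1) z)).
Proof.
apply: is_derive_eq (is_derive_comp_dir (is_derive_japanese2 i z)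
  (is_derive_powR b (japanese2_gt0 z.2))) _.
by rewrite /jpow; ring.
Qed.

Lemma is_derive_jpow1 b i z :
  is_derive z (e i) (fun z => b * 2 * (z.2 ord0 i * jpow (b - 1) z))
   (b * 2 * (jpow (b - 1) z +
     (b - 1) * 2 * (z.2 ord0 i ^+ 2 * jpow (b - 2) z))).
Proof.
have d1 := is_derive_coord i z; have d2 := is_derive_jpow (b - 1) i z.
apply: is_derive_eq (is_deriveZ (b * 2) (is_deriveM d1 d2)) _.
rewrite /GRing.scale/= (_ : b - 1 - 1 = b - 2); last by ring.
by ring.
Qed.

Lemma continuous_coord2 i : continuous (fun z : R * 'rV[R]_N => z.2 ord0 i).
Proof.
move=> z; apply: (@continuous_comp _ _ _ snd (fun x : 'rV[R]_N => x ord0 i)).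
  exact: cvg_snd.
exact: (@coord_continuous R 1 N ord0 i z.2).
Qed.

Lemma continuous_japanese2 : continuous japanese2.
Proof.
apply: (@class_C_continuous _ _ 0).
apply: class_CD; first exact: class_C_cst.
apply: class_C_sum => i; under eq_fun do rewrite expr2.
by apply: class_CM; split=> //; exact: coord_continuous.
Qed.

Lemma continuous_jpow_space b : continuous (fun x => japanese2 x `^ b).
Proof.
move=> x; apply: (@continuous_comp _ _ _ japanese2 (fun y => y `^ b)).
  exact: continuous_japanese2.
apply/differentiable_continuous/derivable1_diffP.
by have [] := is_derive_powR b (japanese2_gt0 x).
Qed.

Lemma continuous_jpow b : continuous (jpow b).
Proof.
move=> z; apply: (@continuous_comp _ _ _ snd (fun x => japanese2 x `^ b)).
  exact: cvg_snd.
exact: continuous_jpow_space.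
Qed.

End stationary_profile.

Lemma continuous_mul (R : realType) (V : normedModType R) (f g : V -> R) :
  continuous f -> continuous g -> continuous (fun z => f z * g z).
Proof. by move=> cf cg z; apply: cvgM; [exact: cf|exact: cg]. Qed.

Lemma continuous_const (R : realType) (V : normedModType R) (b : R) :
  continuous (fun _ : V => b).
Proof. by move=> z; exact: cvg_cst. Qed.

Lemma continuous_add (R : realType) (V : normedModType R) (f g : V -> R) :
  continuous f -> continuous g -> continuous (fun z => f z + g z).
Proof. by move=> cf cg z; apply: cvgD; [exact: cf|exact: cg]. Qed.

Lemma continuous_sub (R : realType) (V : normedModType R) (f g : V -> R) :
  continuous f -> continuous g -> continuous (fun z => f z - g z).
Proof. by move=> cf cg z; apply: cvgB; [exact: cf|exact: cg]. Qed.

Section stationary_solution.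
Context (R : realType) (N : nat) (p a c : R).
Hypotheses (p1 : 1 < p) (a0 : 0 < a) (c0 : 0 < c) (ap : a * p = a + 1)
  (cp : c `^ p = c * (a * (N%:R - 2 - a *+ 2))) (aN : 0 < N%:R - 2 - a *+ 2).
Local Notation mu := (@lebesgue_measure R \x lebesgue_rV N)%E.
Implicit Types (x : 'rV[R]_N) (z : R * 'rV[R]_N).

Definition stat_u z : R := c * jpow (- a) z.

Definition stat_ui (i : 'I_N) z : R :=
  c * (- a * 2 * (z.2 ord0 i * jpow (- a - 1) z)).

Definition stat_uii (i : 'I_N) z : R :=
  c * (- a * 2 * (jpow (- a - 1) z +
    (- a - 1) * 2 * (z.2 ord0 i ^+ 2 * jpow (- a - 2) z))).

(** Minus the Laplacian of [stat_u], with the Euclidean [|x|^2] rewritten as [japanese2 x - 1] to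
    leave a function of [japanese2 x] alone. *)
Definition stat_lap x : R := c * a * 2 *
  (N%:R * japanese2 x `^ (- a - 1) -
   (a + 1) * 2 * ((japanese2 x - 1) * japanese2 x `^ (- a - 2))).

Definition stat_g x : R := stat_lap x - (c * japanese2 x `^ (- a)) `^ p.

Lemma stat_u_gt0 z : 0 < stat_u z.
Proof. by rewrite mulr_gt0// powR_gt0// japanese2_gt0. Qed.

Lemma is_derive_stat_u i z :
  is_derive z (0, delta_mx ord0 i) stat_u (stat_ui i z).
Proof. exact: is_deriveZ (is_derive_jpow (- a) i z). Qed.

Lemma is_derive_stat_ui i z :
  is_derive z (0, delta_mx ord0 i) (stat_ui i) (stat_uii i z).
Proof. exact: is_deriveZ (is_derive_jpow1 (- a) i z). Qed.

Lemma sum_stat_uii z : \sum_(i < N) stat_uii i z = - stat_lap z.2.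
Proof.
rewrite /stat_uii -mulr_sumr -mulr_sumr big_split/= -mulr_sumr -mulr_suml.
rewrite sumr_const card_ord /stat_lap /jpow.
rewrite (_ : japanese2 z.2 - 1 = \sum_(i < N) z.2 ord0 i ^+ 2).
  by rewrite -mulr_natl; ring.
by rewrite /japanese2 addrC addrA addNr add0r.
Qed.

(** With [s = japanese2 x] and [P = s^(-a-2)], minus the Laplacian is
    [2 c a P (s (N - 2 - 2a) + 2 (a + 1))], while [ap] and [cp] turn [u^p] into
    [c a P s (N - 2 - 2a)]. The difference is a sum of positive terms. *)
Lemma stat_g_gt0 x : 0 < stat_g x.
Proof.
have s1 := japanese2_ge1 x; have s0 := japanese2_gt0 x.
rewrite /stat_g powRM ?(ltW c0) ?powR_ge0// -powRrM mulNr ap cp.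
rewrite /stat_lap; set s := japanese2 x in s1 s0 *.
rewrite [- (a + 1)]opprD.
have -> : s `^ (- a - 1) = s * s `^ (- a - 2).
  rewrite -[X in X * _](powRr1 (ltW s0)) -powRD; last first.
    by rewrite (gt_eqF s0) implybT.
  by congr (_ `^ _); ring.
set P := s `^ _; have P0 : 0 < P by rewrite powR_gt0.
rewrite (_ : _ - _ = P * (c * a * (s * (N%:R - 2 - a *+ 2) + (a + 1) * 4))).
  apply: mulr_gt0 => //; apply: mulr_gt0; first exact: mulr_gt0.
  by apply: addr_gt0; [exact: mulr_gt0|rewrite mulr_gt0// addr_gt0].
by ring.
Qed.

Lemma continuous_stat_u : continuous stat_u.
Proof.
by apply: continuous_mul; [exact: continuous_const|exact: continuous_jpow].
Qed.

Lemma continuous_stat_ui i : continuous (stat_ui i).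
Proof.
apply: continuous_mul; first exact: continuous_const.
apply: continuous_mul; first exact: continuous_const.
by apply: continuous_mul; [exact: continuous_coord2|exact: continuous_jpow].
Qed.

Lemma continuous_stat_uii i : continuous (stat_uii i).
Proof.
apply: continuous_mul; first exact: continuous_const.
apply: continuous_mul; first exact: continuous_const.
apply: continuous_add; first exact: continuous_jpow.
apply: continuous_mul; first exact: continuous_const.
apply: continuous_mul; last exact: continuous_jpow.
under eq_fun do rewrite expr2.
by apply: continuous_mul; exact: continuous_coord2.
Qed.

Lemma stat_u_powR z :
  stat_u z `^ p = c `^ p * japanese2 z.2 `^ (- a * p).
Proof. by rewrite powRM ?(ltW c0) ?powR_ge0// -powRrM. Qed.

Lemma continuous_stat_up : continuous (fun z => `|stat_u z| `^ p).
Proof.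
under eq_fun do rewrite (gtr0_norm (stat_u_gt0 _)) stat_u_powR.
apply: continuous_mul; first exact: continuous_const.
exact: (@continuous_jpow R N (- a * p)).
Qed.

Lemma continuous_stat_g : continuous stat_g.
Proof.
rewrite (_ : stat_g = fun x => c * a * 2 *
  (N%:R * japanese2 x `^ (- a - 1) -
   (a + 1) * 2 * ((japanese2 x - 1) * japanese2 x `^ (- a - 2))) -
  c `^ p * japanese2 x `^ (- a * p)); last first.
  apply/funext => x; rewrite /stat_g /stat_lap.
  by rewrite powRM ?(ltW c0) ?powR_ge0// -powRrM.
apply: continuous_sub; last first.
  apply: continuous_mul; first exact: continuous_const.
  exact: continuous_jpow_space.
apply: continuous_mul; first exact: continuous_const.
apply: continuous_sub.
  apply: continuous_mul; first exact: continuous_const.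
  exact: continuous_jpow_space.
apply: continuous_mul; first exact: continuous_const.
apply: continuous_mul; last exact: continuous_jpow_space.
by apply: continuous_sub; [exact: continuous_japanese2|exact: continuous_const].
Qed.

Lemma stat_g_L1 : L1_loc_space stat_g.
Proof.
split; first exact: (continuous_measurable_rV continuous_stat_g).
by move=> K cK; apply: continuous_compact_integral_rV => //;
  exact: continuous_stat_g.
Qed.

Lemma open_halfspace : open (@halfspace R N).
Proof.
rewrite (_ : halfspace = fst @^-1` [set t : R | 0 < t])//.
by apply: open_comp => [z _|]; [exact: cvg_fst|exact: open_gt].
Qed.

Lemma Lp_loc_continuous r (f : R * 'rV[R]_N -> R) : continuous f ->
  continuous (fun z => `|f z| `^ r) -> Lp_loc r halfspace f.
Proof.
move=> cf cfr; split.
  by apply: measurable_funTS; exact: (continuous_measurable_prod cf).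
move=> K _ cK; have := continuous_compact_integral_prod cfr cK.
by under eq_integral do rewrite ger0_norm ?powR_ge0//.
Qed.

(** As [k >= 2], at least one time derivative falls on [psi]. Since [u] is constant in time,
    [u Dt G = Dt (u G)] for the outermost one, and this integrates to zero. *)
Lemma stat_distributional k : (2 <= k)%N ->
  distributional_Dt k.-1 halfspace stat_u (fun=> 0).
Proof.
case: k => [|[|k]]// _ psi tpsi; rewrite succnK.
rewrite [X in _ = _ * X](_ : _ = 0); last first.
  by under eq_Rintegral do rewrite mul0r; rewrite /Rintegral integral0.
rewrite mulr0 iterS; set G := iter k (@Dt R N) psi.
(* [G] uses up [k] derivatives of [psi], so regularity [k.+1] of [psi] leaves exactly the one needed
   to differentiate [u G]. *)
have CG : class_C 1 G.
  have [C _ _] := tpsi k.+1; rewrite /G; elim: k psi {tpsi G} C => // k IH psi C.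
  by rewrite iterSr; apply: IH; exact: class_C_derive.
have sG : support_of G `<=` support_of psi.
  rewrite /G; elim: (k) => // m IH; rewrite iterS.
  exact: subset_trans (@support_of_derive _ _ _ _) IH.
have [A A0 psiA] := test_function_bounded (tpsi 0%N).
have [_ _ spsi] := tpsi 0%N.
rewrite Rintegral_halfspace; last first.
  move=> z nz; rewrite (_ : Dt G z = 0) ?mulr0//; apply: support_of_out.
  by move=> /support_of_derive/sG/spsi.
have u0 z : is_derive z ((1, 0) : R * 'rV[R]_N) stat_u 0.
  apply: is_derive_invariant => h; rewrite /stat_u /jpow /=.
  by rewrite scaler0 add0r.
pose F z := stat_u z * G z.
have dF z : is_derive z ((1, 0) : R * 'rV[R]_N) F (stat_u z * Dt G z).
  have dG := derivableP (class_C_derivable ((1, 0) : R * 'rV[R]_N) z CG).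
  apply: is_derive_eq (is_deriveM (u0 z) dG) _.
  by rewrite scaler0 addr0.
have DF : Dt F = fun z => stat_u z * Dt G z.
  by apply/funext => z; rewrite /Dt; have [_ ->] := dF z.
have dF' z : derivable F z ((1, 0) : R * 'rV[R]_N) by have [] := dF z.
have FCc : Cc F.
  split.
    apply: continuous_mul; first exact: continuous_stat_u.
    exact: class_C_continuous CG.
  exists A => // z /psiA zA.
  by rewrite /F (support_of_out (fun h => zA (sG _ h))) mulr0.
have := Rintegral_Dt_eq0 dF' FCc; rewrite DF; apply.
apply: continuous_mul; first exact: continuous_stat_u.
exact: (class_C_continuous (class_C_derive _ CG)).
Qed.

Lemma stat_weak_solution k q : (2 <= k)%N -> 1 < q ->
  weak_solution k p q (fun z => stat_g z.2) stat_u (fun=> 0).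
Proof.
move=> k2 q1; split.
- exact: Lp_loc_continuous continuous_stat_u continuous_stat_up.
- by apply: Lp_loc_continuous; exact: continuous_const.
- exact: stat_distributional.
move=> phi tphi; have [_ _ sphi] := tphi.
(* The term [|v|^q] with [v = 0] is zero only for a nonzero exponent: the power of 0 with exponent 0
   is 1. *)
have q0 : q != 0 by rewrite gt_eqF// (lt_trans ltr01).
rewrite [X in _ = - X - _](_ : _ = 0); last first.
  by under eq_Rintegral do rewrite mul0r; rewrite /Rintegral integral0.
rewrite oppr0 add0r.
have phi0 z : ~ halfspace z -> phi z = 0.
  by move=> nz; apply: support_of_out => /sphi.
have lphi0 z : ~ halfspace z -> laplacian phi z = 0.
  move=> nz; apply: big1 => i _; apply: support_of_out.
  by move=> /support_of_derive/support_of_derive/sphi.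
rewrite [in LHS]Rintegral_halfspace; last by move=> z /phi0 ->; rewrite mulr0.
rewrite [in RHS]Rintegral_halfspace; last by move=> z /lphi0 ->; rewrite mulr0.
have G i := green_identity continuous_stat_u (@continuous_stat_ui i)
  (@continuous_stat_uii i) (is_derive_stat_u i) (is_derive_stat_ui i) tphi.
transitivity (\int[mu]_z (- \sum_(i < N) stat_uii i z * phi z)).
  apply: eq_Rintegral => z _; rewrite normr0 powR0// addr0 gtr0_norm ?stat_u_gt0//.
  rewrite -mulr_suml sum_stat_uii /stat_g -/(stat_u z) mulNr opprK.
  by rewrite addrC subrK.
under [in RHS]eq_Rintegral do rewrite /laplacian mulr_sumr.
rewrite Rintegral_Cc_sum; last by move=> i; have [] := G i.
under eq_Rintegral do rewrite -mulN1r.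
rewrite RintegralZl//; last first.
  by apply: Cc_integrable; apply: Cc_sum => i; have [] := G i.
rewrite mulN1r Rintegral_Cc_sum; last by move=> i; have [] := G i.
by congr (- _); apply: eq_bigr => i _; have [] := G i.
Qed.

Lemma stat_initial_values k :
  has_initial_values stat_u (fun (i : 'I_k) x =>
    if i == 0%N :> nat then stat_u (0, x) else 0).
Proof.
have D x j : derive1n j (fun s => stat_u (s, x)) =
    fun=> if j == 0%N then stat_u (0, x) else 0.
  elim: j => [|j IH]; first by apply/funext.
  rewrite /derive1n iterS -/(derive1n _ _) IH.
  by apply/funext => t; rewrite derive1_cst.
move=> i x; split; first by move=> j t _ _; rewrite D; exact: derivable_cst.
by rewrite D; exact: cvg_cst.
Qed.

End stationary_solution.

Lemma supercritical_solution (R : realType) (k N : nat) (p q : R) :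
  (2 <= k)%N -> 1 < p -> 1 < q -> (3 <= N)%N -> (pstar R N < p%:E)%E ->
  exists (g : 'rV[R]_N -> R) (u0 : 'I_k -> 'rV[R]_N -> R)
         (u v : R * 'rV[R]_N -> R),
    [/\ L1_loc_space g,
        (forall x, 0 < g x),
        (forall z, halfspace z -> 0 < u z),
        weak_solution k p q (fun z => g z.2) u v &
        has_initial_values u u0].
Proof.
move=> k2 p1 q1 N3; rewrite /pstar leqNgt N3/= lte_fin => pN.
have N2 : 0 < N%:R - 2 :> R by rewrite subr_gt0 ltr_nat.
move: pN; rewrite ltr_pdivrMr// => pN.
have p0 : 0 < p - 1 by rewrite subr_gt0.
pose a := (p - 1)^-1; have a0 : 0 < a by rewrite invr_gt0.
have ap : a * p = a + 1 by rewrite /a; field; rewrite gt_eqF.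
(* This is the supercritical condition [N < p (N - 2)], rewritten as [2 / (p - 1) < N - 2]. *)
have aN : 0 < N%:R - 2 - a *+ 2.
  rewrite subr_gt0 -[a *+ 2]mulr_natl /a ltr_pdivrMr//.
  by lra.
pose M := a * (N%:R - 2 - a *+ 2); have M0 : 0 < M by rewrite mulr_gt0.
(* The solution of [c^(p-1) = M], since [a] is the inverse of [p - 1]. *)
pose c := M `^ a; have c0 : 0 < c by rewrite powR_gt0.
have cp : c `^ p = c * M.
  rewrite /c -powRrM ap powRD ?powRr1 ?(ltW M0)//.
  by rewrite (gt_eqF M0) implybT.
exists (stat_g p a c), (fun (i : 'I_k) x =>
  if i == 0%N :> nat then stat_u a c (0, x) else 0), (stat_u a c), (fun=> 0).
split.
- exact: stat_g_L1.
- by move=> x; exact: stat_g_gt0.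
- by move=> z _; exact: stat_u_gt0.
- exact: stat_weak_solution.
- exact: stat_initial_values.
Qed.

(** * Nonexistence in the subcritical range *)

Section auxiliary_inequalities.
Context (R : realType).

(* Young's inequality for [y] and [D / w^(L - m)], multiplied by [w^L]: the last
   hypothesis makes the power of [w] left in the second term nonnegative. *)
Lemma young_absorb (p y D w : R) (m L : nat) :
  1 < p -> 0 <= y -> 0 <= D -> 0 <= w <= 1 -> (0 < m <= L)%N ->
  (L - m)%:R * (p / (p - 1)) <= L%:R ->
  y * (D * w ^+ m) <= y `^ p * w ^+ L + D `^ (p / (p - 1)).
Proof.
move=> p1 y0 D0 /andP[w0 w1] /andP[m0 mL] Lm.
have p10 : 0 < p - 1 by rewrite subr_gt0.
have p0 : 0 < p by exact: lt_trans p1.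
set p' := p / (p - 1) in Lm *.
have p'0 : 0 < p' by rewrite divr_gt0.
have p'1 : 1 <= p' by rewrite ler_pdivlMr// mul1r gerBl.
have [->|wn0] := eqVneq w 0.
  rewrite expr0n gtn_eqF// !mulr0.
  by rewrite addr_ge0 ?powR_ge0// mulr_ge0 ?powR_ge0// exprn_ge0.
have {w0 wn0}w0 : 0 < w by rewrite lt_neqAle eq_sym wn0.
set E := D / w ^+ (L - m).
have E0 : 0 <= E by rewrite divr_ge0// exprn_ge0// ltW.
rewrite (_ : y * _ = w ^+ L * (y * E)); last first.
  rewrite -(subnKC mL) exprD /E.
  field.
  by rewrite expf_neq0// gt_eqF.
have yE : y * E <= y `^ p + E `^ p'.
  apply: le_trans (conjugate_powR y0 E0 p0 p'0 _) _.
    by rewrite /p'; field; rewrite !gt_eqF.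
  by apply: lerD; rewrite ler_pdivrMr// ler_peMr ?powR_ge0// ltW.
apply: le_trans (ler_wpM2l _ yE) _; first by rewrite exprn_ge0// ltW.
rewrite mulrDr [X in X + _ <= _]mulrC lerD2l.
rewrite /E powRM ?invr_ge0 ?exprn_ge0 ?(ltW w0)//.
rewrite mulrCA ler_piMr ?powR_ge0//.
rewrite -!powR_mulrn ?(ltW w0)// -powR_inv1 ?powR_ge0//.
rewrite -!powRrM -powRD; last by rewrite (gt_eqF w0) implybT.
have t0 : 0 <= L%:R + (L - m)%:R * (-1 * p') by lra.
apply: le_trans (ge0_ler_powR t0 _ _ w1) _; rewrite ?nnegrE ?(ltW w0)//.
by rewrite powR1.
Qed.

Lemma powR_vanish (s C e : R) : 0 < s -> 0 <= C -> 0 < e ->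
  exists2 X, 0 < X & forall x, X <= x -> C * x `^ (- s) <= e.
Proof.
(* [X^s] exceeds [C / e]; the added 1 keeps the base positive when [C = 0]. *)
move=> s0 C0 e0; pose X := (C / e + 1) `^ s^-1.
have B0 : 0 < C / e + 1 by rewrite ltr_wpDl// divr_ge0// ltW.
have X0 : 0 < X by rewrite powR_gt0.
exists X => // x Xx; have x0 : 0 < x by exact: lt_le_trans Xx.
rewrite powRN ler_pdivrMr ?powR_gt0// -ler_pdivrMl// mulrC.
have : X `^ s <= x `^ s by rewrite ge0_ler_powR// ?nnegrE ltW.
rewrite /X -powRrM mulVf ?gt_eqF// powRr1 ?(ltW B0)//.
by apply: le_trans; rewrite lerDl.
Qed.

End auxiliary_inequalities.

Section product_measure_lemmas.
Context d1 d2 (T1 : measurableType d1) (T2 : measurableType d2) (R : realType).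
Variable m1 : {sigma_finite_measure set T1 -> \bar R}.
Variable m2 : {sigma_finite_measure set T2 -> \bar R}.
Local Open Scope ereal_scope.

Lemma integral_rectangle (A : set T1) (C : set T2) (f : T2 -> \bar R) :
  measurable A -> measurable C -> measurable_fun setT f ->
  (forall y, 0 <= f y) ->
  \int[m1 \x m2]_(z in A `*` C) f z.2 = m1 A * \int[m2]_(y in C) f y.
Proof.
move=> mA mC mf f0.
have mfs : measurable_fun [set: T1 * T2] (fun z => f z.2).
  exact: (measurableT_comp mf measurable_snd).
have mfAC := (measurable_restrictT _ (measurableX mA mC)).1
  (@measurable_funTS _ _ _ _ (A `*` C) _ mfs).
have mfC := (measurable_restrictT _ mC).1 (@measurable_funTS _ _ _ _ C _ mf).
rewrite integral_mkcond fubini_tonelli1//; last first.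
  by move=> z; rewrite patchE; case: ifP.
rewrite /fubini_F (_ : (fun x => _) =
    fun x => (\1_A x)%:E * \int[m2]_(y in C) f y); last first.
  apply/funext => x.
  rewrite [in RHS]integral_mkcond -ge0_integralZl//.
  - apply: eq_integral => y _; rewrite !patchE indicE in_setX/=.
    by case: (x \in A); case: (y \in C); rewrite ?mul1e ?mul0e.
  - by move=> y _; rewrite patchE; case: ifP.
have mA1 : measurable_fun [set: T1] (fun x => (\1_A x : R)%:E).
  exact/measurable_EFinP/measurable_indic.
rewrite (ge0_integralZr _ measurableT mA1)//; last exact: integral_ge0.
by rewrite integral_indic// setIT.
Qed.

(** The exceptional set is a cylinder over a null set; its measure is [m1 setT] times 0, which is 0
    even if the first factor is infinite. *)
Lemma ae_snd (P : T2 -> Prop) : {ae m2, forall y, P y} ->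
  {ae m1 \x m2, forall z, P z.2}.
Proof.
move=> [B [mB B0 PB]]; exists (setT `*` B); split; first exact: measurableX.
  by rewrite product_measure1E// B0 mule0.
by move=> z /= Pz; split=> //; exact: PB.
Qed.

End product_measure_lemmas.

(** * The space-time cutoff and its pointwise estimates *)

Section cutoff.
Context (R : realType) (N l : nat) (T r : R).
Hypotheses (T0 : 0 < T) (r0 : 0 < r).
Implicit Types z : R * 'rV[R]_N.

(** It maps [[T, 3T]] onto [[-1, 1]], which places the support of the time bump at positive distance
    from [t = 0]. *)
Definition scaled_t z : R := (z.1 - 2 * T) / T.

Definition scaled_x (i : 'I_N) z : R := z.2 ord0 i / r.

(** Exponent [l.+3] makes every bump of class [C^2]; the free parameter [l] is later taken large in
    terms of [p] and [q]. *)
Definition cutoff z : R :=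
  bump l.+3 (scaled_t z) * \prod_(i < N) bump l.+3 (scaled_x i z).

Definition cutoff_box : set (R * 'rV[R]_N) :=
  `[T, 3 * T]%classic `*` rV_cube r.

Lemma scaled_t_affine (v z : R * 'rV[R]_N) h :
  scaled_t (h *: v + z) = h *: (v.1 / T) + scaled_t z :> R^o.
Proof.
by rewrite /scaled_t /= -![_ *: _]/(_ * _); field; rewrite gt_eqF.
Qed.

Lemma scaled_x_affine i (v z : R * 'rV[R]_N) h :
  scaled_x i (h *: v + z) = h *: (v.2 ord0 i / r) + scaled_x i z :> R^o.
Proof.
by rewrite /scaled_x /= !mxE -![_ *: _]/(_ * _); field; rewrite gt_eqF.
Qed.

Lemma continuous_scaled_t : continuous scaled_t.
Proof.
apply: continuous_mul; last exact: continuous_const.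
apply: continuous_sub; last exact: continuous_const.
by move=> z; exact: cvg_fst.
Qed.

Lemma continuous_scaled_x i : continuous (scaled_x i).
Proof.
by apply: continuous_mul; [exact: continuous_coord2|exact: continuous_const].
Qed.

Lemma class_C_cutoff : class_C 2 cutoff.
Proof.
apply: class_CM.
  apply: (@class_C_comp_affine _ _ R^o _ scaled_t (fun v => v.1 / T)).
  - by move=> v x h; exact: scaled_t_affine.
  - exact: continuous_scaled_t.
  - exact: class_C_bump.
apply: class_C_prod => i.
apply: (@class_C_comp_affine _ _ R^o _ (scaled_x i) (fun v => v.2 ord0 i / r)).
- by move=> v x h; exact: scaled_x_affine.
- exact: continuous_scaled_x.
- exact: class_C_bump.
Qed.

Lemma cutoff_ge0 z : 0 <= cutoff z.
Proof.
rewrite /cutoff mulr_ge0 ?bumpE ?exprn_ge0 ?bumpw_ge0// prodr_ge0// => i _.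
by rewrite bumpE exprn_ge0// bumpw_ge0.
Qed.

Lemma bump_itv (s : R) : 0 <= bump l.+3 s <= 1.
Proof.
by rewrite bumpE exprn_ge0 ?bumpw_ge0//= exprn_ile1 ?bumpw_ge0 ?bumpw_le1.
Qed.

Lemma prod_bump_itv (P : pred 'I_N) z :
  0 <= \prod_(i < N | P i) bump l.+3 (scaled_x i z) <= 1.
Proof.
rewrite prodr_ge0/=; last by move=> i _; have /andP[] := bump_itv (scaled_x i z).
by apply: Num.Theory.prodr_ile1 => i _; exact: bump_itv.
Qed.

Lemma cutoff_box_compact : compact cutoff_box.
Proof. exact: compact_setX (@segment_compact _ _ _) (@rV_cube_compact R N r). Qed.

Lemma cutoff_box_halfspace : cutoff_box `<=` halfspace.
Proof.
by move=> z [/=]; rewrite in_itv/= => /andP[Tz _] _; exact: lt_le_trans Tz.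
Qed.

Lemma support_cutoff : support_of cutoff `<=` cutoff_box.
Proof.
rewrite (closure_id cutoff_box).1; last first.
  exact: compact_closed (@norm_hausdorff _ _) cutoff_box_compact.
apply: closure_subset => z; rewrite /= /cutoff mulf_eq0 negb_or => /andP[].
rewrite bumpE expf_eq0/= => /bumpw_neq0; rewrite /scaled_t ltr_norml.
rewrite ltr_pdivlMr// ltr_pdivrMr// => /andP[t1 t2] /prodf_neq0 Pn0; split.
  by rewrite /= in_itv/=; apply/andP; split; lra.
move=> i; have := Pn0 i isT; rewrite bumpE expf_eq0/= => /bumpw_neq0.
rewrite /scaled_x ltr_norml ltr_pdivlMr// ltr_pdivrMr// mulN1r mul1r.
by rewrite /= in_itv/= => /andP[/ltW -> /ltW ->].
Qed.

Lemma test_function_cutoff : test_function 2 halfspace cutoff.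
Proof.
split; first exact: class_C_cutoff.
- apply: (subclosed_compact _ cutoff_box_compact support_cutoff).
  exact: closed_closure.
- exact: subset_trans support_cutoff cutoff_box_halfspace.
Qed.

Lemma is_derive_cutoff_t z : is_derive z ((1, 0) : R * 'rV[R]_N) cutoff
  (T^-1 * bump1 l.+1 (scaled_t z) * \prod_(i < N) bump l.+3 (scaled_x i z)).
Proof.
have d1 : is_derive z ((1, 0) : R * 'rV[R]_N) (bump l.+3 \o scaled_t)
    (T^-1 * bump1 l.+1 (scaled_t z)).
  apply: (@is_derive_reparam _ _ R^o _ _ T^-1).
    by move=> h; rewrite scaled_t_affine/= mul1r.
  by apply: is_derive_dir; exact: is_derive_bump.
have d2 : is_derive z ((1, 0) : R * 'rV[R]_N)
    (fun z => \prod_(i < N) bump l.+3 (scaled_x i z)) 0.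
  apply: is_derive_invariant => h; apply: eq_bigr => i _.
  by rewrite scaled_x_affine/= mxE mul0r scaler0 add0r.
apply: is_derive_eq (is_deriveM d1 d2) _.
by rewrite /GRing.scale/= mulr0 add0r mulrC.
Qed.

(** Constant along the [i]-th direction, so both space derivatives in that direction fall on the
    single remaining factor. *)
Definition cutoff_but i z : R :=
  bump l.+3 (scaled_t z) * \prod_(j < N | j != i) bump l.+3 (scaled_x j z).

Lemma cutoffE i z : cutoff z = bump l.+3 (scaled_x i z) * cutoff_but i z.
Proof. by rewrite /cutoff (bigD1 i)//= mulrCA. Qed.

Lemma is_derive_cutoff_but i z :
  is_derive z ((0, delta_mx ord0 i) : R * 'rV[R]_N) (cutoff_but i) 0.
Proof.
apply: is_derive_invariant => h; rewrite /cutoff_but.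
rewrite scaled_t_affine/= mul0r scaler0 add0r; congr (_ * _).
apply: eq_bigr => j ji.
by rewrite scaled_x_affine/= mxE (negPf ji) andbF mul0r scaler0 add0r.
Qed.

Lemma is_derive_scaled_x (f df : R -> R) i z :
  (forall s, is_derive s (1 : R) f (df s)) ->
  is_derive z ((0, delta_mx ord0 i) : R * 'rV[R]_N) (f \o scaled_x i)
    (r^-1 * df (scaled_x i z)).
Proof.
move=> dfE; apply: (@is_derive_reparam _ _ R^o _ _ r^-1).
  by move=> h; rewrite scaled_x_affine/= mxE !eqxx mul1r.
by apply: is_derive_dir; exact: dfE.
Qed.

Lemma Dx_cutoff i : Dx i cutoff =
  fun z => r^-1 * (bump1 l.+1 (scaled_x i z) * cutoff_but i z).
Proof.
apply/funext => z.
have d1 := is_derive_scaled_x i z (@is_derive_bump R l.+1).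
have [_ D] := is_deriveM d1 (is_derive_cutoff_but i z).
rewrite /Dx (_ : cutoff = (bump l.+3 \o scaled_x i) * cutoff_but i).
  by rewrite D /GRing.scale/=; ring.
by apply/funext => y; rewrite (cutoffE i).
Qed.

Lemma DDx_cutoff i z : Dx i (Dx i cutoff) z =
  r^-2 * (bump2 l (scaled_x i z) * cutoff_but i z).
Proof.
rewrite Dx_cutoff.
have d1 := is_derive_scaled_x i z (@is_derive_bump1 R l).
have [_ D] := is_deriveZ r^-1 (is_deriveM d1 (is_derive_cutoff_but i z)).
rewrite /Dx [LHS]D /GRing.scale/= -exprVn; ring.
Qed.

(** One derivative lowers the power of the time factor by one, so [young_absorb] is used with
    [L - m = 1]. The space product [K] lies in [[0, 1]]: it is kept in the absorbed term and dropped
    from the error. *)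
Lemma cutoff_Dt_le q (V : R) z : 1 < q -> q / (q - 1) <= l.+3%:R ->
  `|V| * `|Dt cutoff z| <=
  `|V| `^ q * cutoff z + (l.+3%:R *+ 2 / T) `^ (q / (q - 1)).
Proof.
move=> q1 ql; rewrite /Dt; have [_ ->] := is_derive_cutoff_t z.
set K := \prod_(i < N) _; have /andP[K0 K1] : 0 <= K <= 1 by exact: prod_bump_itv.
have w01 : 0 <= bumpw (scaled_t z) <= 1 by rewrite bumpw_ge0 bumpw_le1.
set w := bumpw _ in w01 *.
have D0 : 0 <= l.+3%:R *+ 2 / T by rewrite divr_ge0 ?mulrn_wge0// ltW.
have Y : `|V| * (l.+3%:R *+ 2 / T * w ^+ l.+2) <=
    `|V| `^ q * w ^+ l.+3 + (l.+3%:R *+ 2 / T) `^ (q / (q - 1)).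
  by apply: young_absorb => //; rewrite ?leqnSn// subSnn mul1r.
rewrite /cutoff -/K bumpE -/w [`|V| `^ q * _]mulrA.
apply: (@le_trans _ _ (`|V| * (l.+3%:R *+ 2 / T * w ^+ l.+2) * K)).
  rewrite [`|_ * K|]normrM [`|T^-1 * _|]normrM (ger0_norm K0) mulrA.
  rewrite ler_wpM2r// ler_wpM2l//.
  rewrite (gtr0_norm (_ : 0 < T^-1)) ?invr_gt0//.
  rewrite (_ : _ * w ^+ _ = T^-1 * (l.+3%:R *+ 2 * w ^+ l.+2)); last by ring.
  rewrite ler_wpM2l ?invr_ge0 ?(ltW T0)//.
  exact: bump1_le.
apply: le_trans (ler_wpM2r K0 Y) _; rewrite mulrDl lerD2l.
by rewrite ler_piMr// powR_ge0.
Qed.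

(** The factor [N] on the left shares out [|U|^p] among the [N] summands of the Laplacian, each of
    which may absorb only its [N]-th part. Here [L - m = 2], whence the condition on [2p']. *)
Lemma cutoff_DDx_le p (U : R) i z : 1 < p -> 2 * (p / (p - 1)) <= l.+3%:R ->
  `|U| * `|Dx i (Dx i cutoff) z| *+ N <=
  `|U| `^ p * cutoff z + (N%:R * (10 * l.+3%:R ^+ 2) / r ^+ 2) `^ (p / (p - 1)).
Proof.
move=> p1 pl; rewrite DDx_cutoff (cutoffE i).
set K := cutoff_but i z; have /andP[K0 K1] : 0 <= K <= 1.
  have /andP[b0 b1] := bump_itv (scaled_t z).
  have /andP[k0 k1] := prod_bump_itv (fun j => j != i) z.
  by rewrite mulr_ge0//= mulr_ile1.
have w01 : 0 <= bumpw (scaled_x i z) <= 1 by rewrite bumpw_ge0 bumpw_le1.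
set w := bumpw _ in w01 *; set D := N%:R * (10 * l.+3%:R ^+ 2) / r ^+ 2.
have D0 : 0 <= D by rewrite divr_ge0 ?mulr_ge0 ?exprn_ge0// ltW.
have Y : `|U| * (D * w ^+ l.+1) <= `|U| `^ p * w ^+ l.+3 + D `^ (p / (p - 1)).
  apply: young_absorb => //; first by rewrite /= leqW.
  by have -> : (l.+3 - l.+1 = 2)%N by rewrite !subSS -addn2 addKn.
rewrite bumpE -/w [`|U| `^ p * _]mulrA.
apply: (@le_trans _ _ (`|U| * (D * w ^+ l.+1) * K)).
  rewrite [`|r^-2 * _|]normrM (ger0_norm (_ : 0 <= r^-2)); last first.
    by rewrite invr_ge0 exprn_ge0// ltW.
  rewrite [`|_ * K|]normrM (ger0_norm K0) -mulr_natl /D.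
  have := bump2_le l (scaled_x i z); rewrite -/w => B.
  rewrite (_ : N%:R * _ =
    `|U| * (N%:R / r ^+ 2 * `|bump2 l (scaled_x i z)|) * K); last by ring.
  rewrite (_ : _ * w ^+ l.+1 =
    N%:R / r ^+ 2 * (10 * l.+3%:R ^+ 2 * w ^+ l.+1)); last by ring.
  rewrite ler_wpM2r// ler_wpM2l// ler_wpM2l// divr_ge0// exprn_ge0//.
  exact: ltW.
apply: le_trans (ler_wpM2r K0 Y) _; rewrite mulrDl lerD2l.
by rewrite ler_piMr// powR_ge0.
Qed.

Definition cutoff_cost (p q : R) : R := (l.+3%:R *+ 2 / T) `^ (q / (q - 1)) +
  (N%:R * (10 * l.+3%:R ^+ 2) / r ^+ 2) `^ (p / (p - 1)).

(** A pointwise inequality between real numbers, valid for any values [U] and [V]: the nonlinear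
    terms absorb all dependence on the solution and a constant is left. *)
Lemma cutoff_cost_le p q (U V : R) z : (0 < N)%N -> 1 < p -> 1 < q ->
  2 * (p / (p - 1)) <= l.+3%:R -> q / (q - 1) <= l.+3%:R ->
  - (V * Dt cutoff z) - U * laplacian cutoff z <=
  (`|U| `^ p + `|V| `^ q) * cutoff z + cutoff_cost p q.
Proof.
move=> N0 p1 q1 pl ql; have HV := cutoff_Dt_le V z q1 ql.
have N0' : 0 < N%:R :> R by rewrite ltr0n.
set A := `|U| `^ p * cutoff z +
  (N%:R * (10 * l.+3%:R ^+ 2) / r ^+ 2) `^ (p / (p - 1)).
have HU : `|U * laplacian cutoff z| <= A.
  rewrite /laplacian mulr_sumr (le_trans (ler_norm_sum _ _ _))//.
  apply: (@le_trans _ _ (\sum_(i < N) A / N%:R)).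
    apply: ler_sum => i _; rewrite normrM ler_pdivlMr// mulr_natr.
    exact: cutoff_DDx_le.
  by rewrite sumr_const card_ord -[X in X <= _]mulr_natr divfK// gt_eqF.
have := ler_norm (- (U * laplacian cutoff z)); rewrite normrN => HU'.
have := ler_norm (- (V * Dt cutoff z)); rewrite normrN normrM => HV'.
rewrite /cutoff_cost mulrDl.
rewrite [X in _ <= X](_ : _ = (`|V| `^ q * cutoff z +
  (l.+3%:R *+ 2 / T) `^ (q / (q - 1))) + A); last by rewrite /A; ring.
apply: lerD; [exact: le_trans HV' HV|exact: le_trans HU' HU].
Qed.

Definition cutoff_inner_box : set (R * 'rV[R]_N) :=
  `[3 / 2 * T, 5 / 2 * T]%classic `*` rV_cube (r / 2).

(** On the inner box all [N.+1] scaled variables are at most [1/2] in absolute value, where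
    [1 - s^2 >= 3/4]. *)
Lemma cutoff_inner_ge z : cutoff_inner_box z ->
  (3 / 4) ^+ (l.+3 * N.+1) <= cutoff z.
Proof.
move=> [/= tz xz]; rewrite exprM exprS /cutoff.
have c0 : 0 <= (3 / 4) ^+ l.+3 :> R by rewrite exprn_ge0//; lra.
have B s : `|s| <= 2^-1 -> (3 / 4) ^+ l.+3 <= bump l.+3 s :> R.
  by move=> /bumpw_in s2; rewrite bumpE lerXn2r ?nnegrE ?bumpw_ge0//; lra.
apply: ler_pM => //.
  apply: B; rewrite /scaled_t ler_norml ler_pdivlMr// ler_pdivrMr//.
  by move: tz; rewrite in_itv/= => /andP[? ?]; apply/andP; split; lra.
rewrite -[X in _ ^+ X]card_ord -prodr_const; apply: ler_prod => i _.
apply/andP; split=> //; apply: B; rewrite /scaled_x ler_norml.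
rewrite ler_pdivlMr// ler_pdivrMr//.
by have := xz i; rewrite /= in_itv/= => /andP[? ?]; apply/andP; split; lra.
Qed.

End cutoff.

(** * Integrability on sets of finite measure *)

Section integrability_on_finite_measure.
Context d (T : measurableType d) (R : realType).
Variables (mu : {measure set T -> \bar R}) (D : set T).
Hypotheses (mD : measurable D) (muD : (mu D < +oo)%E).

Lemma integrable_mul_bounded (f h : T -> R) :
  mu.-integrable D (EFin \o f) -> measurable_fun D h ->
  [bounded h x | x in D] -> mu.-integrable D (EFin \o (fun z => f z * h z)).
Proof.
move=> fi mh bh; have := integrableMl mD fi mh bh.
by apply: eq_integrable => // z _; rewrite /= EFinM.
Qed.

Lemma integrable_cst_finite (c : R) : mu.-integrable D (EFin \o (fun=> c)).
Proof.
apply: measurable_bounded_integrable => //; exact: bounded_cst.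
Qed.

Lemma le_add1_powR (y p : R) : 0 <= y -> 1 <= p -> y <= 1 + y `^ p.
Proof.
move=> y0 p1; have [y1|/ltW y1] := leP y 1.
  by rewrite (le_trans y1)// lerDl powR_ge0.
by rewrite (le_trans (le1r_powR y1 p1))// lerDr.
Qed.

Lemma measurable_normr_powR (u : T -> R) p :
  measurable_fun D u -> measurable_fun D (fun z => `|u z| `^ p).
Proof.
move=> mu'; apply: (measurableT_comp (measurable_powR p)).
exact: measurableT_comp.
Qed.

Lemma integrable_normr_powR (u : T -> R) p : measurable_fun D u ->
  (\int[mu]_(z in D) (`|u z| `^ p)%:E < +oo)%E ->
  mu.-integrable D (EFin \o (fun z => `|u z| `^ p)).
Proof.
move=> mu' up; apply/integrableP; split.
  exact/measurable_EFinP/measurable_normr_powR.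
by under eq_integral do rewrite /= ger0_norm ?powR_ge0//.
Qed.

(** On a set of finite measure [1 + |u|^p] is an integrable majorant of [|u|]. This makes
    [u laplacian phi] and [v Dt phi] integrable on the box. *)
Lemma integrable_of_powR (u : T -> R) p : 1 <= p -> measurable_fun D u ->
  mu.-integrable D (EFin \o (fun z => `|u z| `^ p)) ->
  mu.-integrable D (EFin \o u).
Proof.
move=> p1 mu' up.
apply: (le_integrable mD _ _ (integrableD mD (integrable_cst_finite 1) up)).
  exact/measurable_EFinP.
move=> z _; rewrite /= lee_fin [leRHS]ger0_norm ?addr_ge0 ?powR_ge0//.
exact: le_add1_powR.
Qed.

(** It brings the half-space integrals of the weak formulation to the compact box, where local
    integrability can be used. *)
Lemma Rintegral_vanish (E : set T) (F : T -> R) : D `<=` E ->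
  (forall z, ~ D z -> F z = 0) ->
  \int[mu]_(z in E) F z = \int[mu]_(z in D) F z.
Proof.
move=> DE F0; rewrite Rintegral_mkcond [RHS]Rintegral_mkcond; congr Rintegral.
apply/funext => z; rewrite !patchE; case: ifPn => zE; case: ifPn => zD //.
- by apply: F0 => Dz; move/negP : zD; apply; exact: mem_set.
- by exfalso; move/negP : zE; apply; apply/mem_set/DE/set_mem.
Qed.

End integrability_on_finite_measure.

(** * Two-sided estimate of the integral of the source against the cutoff *)

Section cutoff_estimate.
Context (R : realType) (k N l : nat) (p q : R) (g : 'rV[R]_N -> R).
Context (u v : R * 'rV[R]_N -> R) (T r : R).
Hypotheses (N0 : (0 < N)%N) (p1 : 1 < p) (q1 : 1 < q) (T0 : 0 < T) (r0 : 0 < r)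
  (pl : 2 * (p / (p - 1)) <= l.+3%:R) (ql : q / (q - 1) <= l.+3%:R)
  (gL1 : L1_loc_space g) (g0 : {ae lebesgue_rV N, forall x, 0 <= g x})
  (uv : weak_solution k p q (fun z => g z.2) u v).
Local Notation mu := (@lebesgue_measure R \x lebesgue_rV N)%E.
Local Notation B := (@cutoff_box R N T r).
Local Notation phi := (@cutoff R N l T r).
Local Notation cost := (@cutoff_cost R N l T r p q).

Lemma measure_time_box (a b s : R) : a <= b -> 0 <= s ->
  mu (`[a, b]%classic `*` rV_cube s) = ((b - a) * (s *+ 2) ^+ N)%:E.
Proof.
move=> ab s0; rewrite product_measure1E//; last exact: rV_cube_measurable.
rewrite [X in (X * _)%E](_ : _ = (b - a)%:E); last exact: lebesgue_segment.
rewrite [X in (_ * X)%E](_ : _ = ((s *+ 2) ^+ N)%:E) -?EFinM//.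
exact: lebesgue_rV_cube.
Qed.

(* [R] carries two convertible measurable structures with different displays;
   the annotations with [measurableTypeR] select the one of [mu]. *)
Let mB : measurable (B : set (measurableTypeR R * 'rV[R]_N)).
Proof. exact: compact_measurable_prod (@cutoff_box_compact R N T r). Qed.

Let T3 : T <= 3 * T. Proof. by move: T0 => ?; lra. Qed.

Let muB : mu B = (2 * T * (r *+ 2) ^+ N)%:E.
Proof.
by rewrite (measure_time_box T3 (ltW r0)); congr EFin; ring.
Qed.

Let muBoo : (mu B < +oo)%E. Proof. by rewrite muB ltry. Qed.

Let measurable_on (f : R * 'rV[R]_N -> R) : measurable_fun halfspace f ->
  measurable_fun (B : set (measurableTypeR R * 'rV[R]_N)) f.
Proof.
apply: measurable_funS; first exact: (open_measurable_prod (@open_halfspace R N)).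
exact: cutoff_box_halfspace.
Qed.

Let continuous_on (f : R * 'rV[R]_N -> R) : continuous f ->
  measurable_fun (B : set (measurableTypeR R * 'rV[R]_N)) f.
Proof. by move=> cf; exact: measurable_funTS (continuous_measurable_prod cf). Qed.

Let bounded_on (f : R * 'rV[R]_N -> R) : continuous f -> [bounded f z | z in B].
Proof.
by move=> cf; exact: continuous_compact_bounded cf (@cutoff_box_compact R N T r).
Qed.

Let integrable_Lp (f : R * 'rV[R]_N -> R) s : Lp_loc s halfspace f ->
  mu.-integrable B (EFin \o (fun z => `|f z| `^ s)).
Proof.
move=> [mf fs]; apply: integrable_normr_powR; first exact: measurable_on.
exact: (fs _ (@cutoff_box_halfspace R N T r T0) (@cutoff_box_compact R N T r)).
Qed.

Let measurable_g :
  measurable_fun [set: measurableTypeR R * 'rV[R]_N] (fun z => g z.2).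
Proof. by have [mg _] := gL1; exact: (measurableT_comp mg measurable_snd). Qed.

Let integrable_g : mu.-integrable B (EFin \o (fun z => g z.2)).
Proof.
have [mg gK] := gL1; apply/integrableP; split.
  by apply/measurable_EFinP; exact: measurable_funTS measurable_g.
rewrite (_ : (\int[_]_(_ in _) _)%E =
    (\int[mu]_(z in B) (fun y => `|g y|%:E) z.2)%E)//.
rewrite (@integral_rectangle _ _ _ _ _ lebesgue_measure (lebesgue_rV N)
  `[T, 3 * T]%classic (rV_cube r) (fun y => `|g y|%:E))//.
- rewrite [X in (X * _)%E](_ : _ = (3 * T - T)%:E); last first.
    exact: lebesgue_segment.
  rewrite lte_mul_pinfty ?lee_fin ?subr_ge0//.
  exact: (gK _ (@rV_cube_compact R N r)).
- exact: rV_cube_measurable.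
- by apply/measurable_EFinP; exact: (measurableT_comp (@normr_measurable R setT) mg).
Qed.

(** By [cutoff_cost_le], [g phi - cost] is at most the sum of all terms of the weak equation moved
    to one side, which integrates to zero. So the integral of [g phi] is at most [cost] times the
    volume of the box. *)
Lemma cutoff_upper :
  (\int[mu]_(z in B) (g z.2 * phi z)%:E <=
   (cost * (2 * T * (r *+ 2) ^+ N))%:E)%E.
Proof.
have [uL vL _ weak] := uv; have tphi := test_function_cutoff N l T0 r0.
have [Cphi _ _] := tphi; have cphi := class_C_continuous Cphi.
have cDt : continuous (Dt phi).
  exact: class_C_continuous (class_C_derive _ Cphi).
have clap : continuous (laplacian phi).
  apply: (@class_C_continuous _ _ 0); apply: class_C_sum => i.
  exact: class_C_derive (class_C_derive _ Cphi).
have phi0 z : ~ B z -> phi z = 0.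
  by move=> nB; apply: support_of_out => /(support_cutoff T0 r0).
have Dt0 z : ~ B z -> Dt phi z = 0.
  by move=> nB; apply: support_of_out => /support_of_derive/(support_cutoff T0 r0).
have lap0 z : ~ B z -> laplacian phi z = 0.
  move=> nB; apply: big1 => i _; apply: support_of_out.
  by move=> /support_of_derive/support_of_derive/(support_cutoff T0 r0).
have iu := integrable_Lp uL; have iv := integrable_Lp vL.
have iu1 := integrable_of_powR mB muBoo (ltW p1) (measurable_on (proj1 uL)) iu.
have iv1 := integrable_of_powR mB muBoo (ltW q1) (measurable_on (proj1 vL)) iv.
have igp := integrable_mul_bounded mB integrable_g (continuous_on cphi)
  (bounded_on cphi).
have iF1 : mu.-integrable B
    (EFin \o (fun z => (`|u z| `^ p + `|v z| `^ q + g z.2) * phi z)).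
  apply: integrable_mul_bounded => //; [|exact: continuous_on|exact: bounded_on].
  have := integrableD mB (integrableD mB iu iv) integrable_g.
  by apply: eq_integrable => // z _; rewrite /= !EFinD.
have iF2 := integrable_mul_bounded mB iv1 (continuous_on cDt) (bounded_on cDt).
have iF3 := integrable_mul_bounded mB iu1 (continuous_on clap) (bounded_on clap).
have BH := @cutoff_box_halfspace R N T r T0.
have := weak phi tphi.
rewrite (@Rintegral_vanish _ _ _ mu B halfspace _ BH); last first.
  by move=> z /phi0 ->; rewrite mulr0.
rewrite (@Rintegral_vanish _ _ _ mu B halfspace _ BH); last first.
  by move=> z /Dt0 ->; rewrite mulr0.
rewrite (@Rintegral_vanish _ _ _ mu B halfspace _ BH); last first.
  by move=> z /lap0 ->; rewrite mulr0.
move=> W.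
have iF23 : mu.-integrable B
    (EFin \o (fun z => v z * Dt phi z + u z * laplacian phi z)).
  have := integrableD mB iF2 iF3.
  by apply: eq_integrable => // z _; rewrite /= EFinD.
have W23 := RintegralD mB iF2 iF3.
have ic := integrable_cst_finite mB muBoo cost.
have iL : mu.-integrable B (EFin \o (fun z => g z.2 * phi z - cost)).
  have := integrableB mB igp ic.
  by apply: eq_integrable => // z _; rewrite /= EFinB.
have iR : mu.-integrable B (EFin \o
    (fun z => (`|u z| `^ p + `|v z| `^ q + g z.2) * phi z +
      (v z * Dt phi z + u z * laplacian phi z))).
  have := integrableD mB iF1 iF23.
  by apply: eq_integrable => // z _; rewrite /= EFinD.
have := le_Rintegral mB iL iR.
have -> : \int[mu]_(z in B) ((`|u z| `^ p + `|v z| `^ q + g z.2) * phi z +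
      (v z * Dt phi z + u z * laplacian phi z)) = 0.
  by rewrite (RintegralD mB iF1 iF23) W23 W; ring.
rewrite (RintegralB mB igp ic) (Rintegral_cst _ mB).
rewrite [fine _](_ : _ = 2 * T * (r *+ 2) ^+ N); last exact: (congr1 fine muB).
move=> H.
(* Integrability makes the extended integral finite, so the comparison of real integrals can be read
   in the extended reals, where the lower bound lives. *)
rewrite -(fineK (integrable_fin_num mB igp)) lee_fin -subr_le0; apply: H.
move=> z _.
have := @cutoff_cost_le R N l T r T0 r0 p q (u z) (v z) z N0 p1 q1 pl ql.
rewrite !mulrDl; lra.
Qed.

(** [g] is nonnegative only almost everywhere; this representative is so everywhere, as monotonicity
    in the domain of integration demands. *)
Let gp (x : 'rV[R]_N) : R := Num.max (g x) 0.

Let measurable_gp : measurable_fun setT gp.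
Proof.
by have [mg _] := gL1; apply: measurable_maxr => //; exact: measurable_cst.
Qed.

(** The integral shrinks when restricted to the inner box, where the cutoff is bounded below; that
    box has time length [5/2 T - 3/2 T = T]. *)
Lemma cutoff_lower :
  (((3 / 4) ^+ (l.+3 * N.+1) * T)%:E *
    \int[lebesgue_rV N]_(x in rV_cube (r / 2)) (gp x)%:E <=
   \int[mu]_(z in B) (g z.2 * phi z)%:E)%E.
Proof.
set c := (3 / 4) ^+ _; have c0 : 0 <= c by rewrite exprn_ge0//; lra.
have cphi := class_C_continuous (class_C_cutoff N l T0 r0).
have mgp2 : measurable_fun [set: measurableTypeR R * 'rV[R]_N]
    (fun z => gp z.2).
  exact: (measurableT_comp measurable_gp measurable_snd).
have gp0 x : 0 <= gp x by rewrite le_max lexx orbT.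
have mgpphi : measurable_fun (B : set (measurableTypeR R * 'rV[R]_N))
    (fun z => (gp z.2 * phi z)%:E).
  apply/measurable_EFinP; apply: measurable_funM; last exact: continuous_on.
  exact: measurable_funTS mgp2.
rewrite (_ : (\int[mu]_(z in B) _ = \int[mu]_(z in B) (gp z.2 * phi z)%:E)%E);
    last first.
  apply: ae_eq_integral => //.
    apply/measurable_EFinP; apply: measurable_funM; last exact: continuous_on.
    exact: measurable_funTS measurable_g.
  have := ae_snd lebesgue_measure g0; apply: filterS => z gz _.
  by rewrite /gp max_l.
pose I := @cutoff_inner_box R N T r.
have mI : measurable (I : set (measurableTypeR R * 'rV[R]_N)).
  by apply: measurableX => //; exact: rV_cube_measurable.
have IB : I `<=` B.
  move: T0 r0 => T0' r0' z [/= tz xz]; split.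
    by move: tz; rewrite /= !in_itv/= => /andP[? ?]; apply/andP; split; lra.
  move=> i; have := xz i; rewrite /= !in_itv/= => /andP[? ?].
  by apply/andP; split; lra.
have pos z : B z -> (0 <= (gp z.2 * phi z)%:E)%E.
  by move=> _; rewrite lee_fin mulr_ge0// cutoff_ge0.
have sub := @ge0_subset_integral _ _ _ mu I B mI mB _ mgpphi pos IB.
apply: le_trans sub.
apply: (@le_trans _ _ (\int[mu]_(z in I) (fun x => (c * gp x)%:E) z.2)%E).
  rewrite (@integral_rectangle _ _ _ _ _ lebesgue_measure (lebesgue_rV N)
    `[3 / 2 * T, 5 / 2 * T]%classic (rV_cube (r / 2)) (fun x => (c * gp x)%:E))//.
  - rewrite [X in (_ <= X * _)%E](_ : _ = T%:E); last first.
      rewrite -[T in RHS](_ : 5 / 2 * T - 3 / 2 * T = T); last by field.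
      by apply: lebesgue_segment; move: T0 => ?; lra.
    under [X in (_ <= _ * X)%E]eq_integral do rewrite EFinM.
    rewrite ge0_integralZl_EFin//.
    + by rewrite muleA -EFinM mulrC.
    + exact: rV_cube_measurable.
    + by move=> x _; rewrite lee_fin.
    + by apply/measurable_EFinP; exact: measurable_funTS measurable_gp.
  - exact: rV_cube_measurable.
  - apply/measurable_EFinP; apply: measurable_funM => //; exact: measurable_cst.
  - by move=> x; rewrite lee_fin mulr_ge0.
apply: ge0_le_integral => //.
- by move=> z _; rewrite lee_fin mulr_ge0.
- apply/measurable_EFinP; apply: measurable_funM; first exact: measurable_cst.
  exact: measurable_funTS mgp2.
- exact: measurable_funS mgpphi.
- move=> z Iz; rewrite lee_fin mulrC ler_wpM2l//.
  exact: cutoff_inner_ge.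
Qed.

End cutoff_estimate.

(** * Passage to the limit and vanishing of the source *)

Section nonexistence.
Context (R : realType) (k N : nat) (p q : R) (g : 'rV[R]_N -> R).
Context (u v : R * 'rV[R]_N -> R).
Hypotheses (N0 : (0 < N)%N) (p1 : 1 < p) (q1 : 1 < q)
  (pN : (p%:E < pstar R N)%E)
  (gL1 : L1_loc_space g) (g0 : {ae lebesgue_rV N, forall x, 0 <= g x})
  (uv : weak_solution k p q (fun z => g z.2) u v).

(** For [N <= 2] it follows from [p' > 1]; for [N >= 3] it is [p (N - 2) < N] rearranged. *)
Lemma subcritical_conjugate : N%:R < 2 * (p / (p - 1)).
Proof.
have p10 : 0 < p - 1 by rewrite subr_gt0.
move: pN; rewrite /pstar mulrA ltr_pdivlMr//; case: ifPn => [N2 _|].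
  have : N%:R <= 2 :> R by rewrite ler_nat.
  by move: p1 => ? ?; nra.
rewrite -ltnNge => N3; have N2 : 0 < N%:R - 2 :> R by rewrite subr_gt0 ltr_nat.
by rewrite lte_fin ltr_pdivlMr// => ?; lra.
Qed.

Let gp (x : 'rV[R]_N) : R := Num.max (g x) 0.

(** [C] is chosen before [T] and [r], which is what permits the two limits; both powers that should
    vanish appear with negative exponent. *)
Lemma cutoff_bound l : 2 * (p / (p - 1)) <= l.+3%:R -> q / (q - 1) <= l.+3%:R ->
  exists2 C, 0 <= C & forall T r, 0 < T -> 0 < r ->
  (\int[lebesgue_rV N]_(x in rV_cube (r / 2)) (gp x)%:E <=
   (C * (r `^ N%:R * (l.+3%:R *+ 2) `^ (q / (q - 1)) * T `^ (- (q / (q - 1))) +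
      (N%:R * (10 * l.+3%:R ^+ 2)) `^ (p / (p - 1)) *
      r `^ (- (2 * (p / (p - 1)) - N%:R))))%:E)%E.
Proof.
move=> pl ql; set c : R := (3 / 4) ^+ (l.+3 * N.+1).
have c0 : 0 < c by rewrite exprn_gt0//; lra.
exists (2 * 2 ^+ N / c); first by rewrite divr_ge0 ?mulr_ge0 ?exprn_ge0// ltW.
move=> T r T0 r0.
have L := cutoff_lower l T0 r0 gL1 g0.
have U := cutoff_upper N0 p1 q1 T0 r0 pl ql gL1 uv.
have := le_trans L U; rewrite -/c.
rewrite -lee_pdivlMl ?mulr_gt0// => /le_trans; apply.
(* After division by [c * T] the two sides are equal: the box volume [2T (2r)^N] supplies the factor
   [T] that cancels. *)
rewrite -EFinM lee_fin le_eqVlt; apply/orP; left; apply/eqP.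
have Ti s : T^-1 `^ s = T `^ (- s).
  by rewrite -powR_inv1 ?(ltW T0)// -powRrM mulN1r.
have ri s : (r ^+ 2)^-1 `^ s = r `^ (- (2 * s)).
  rewrite -powR_mulrn ?(ltW r0)// -powR_inv1 ?powR_ge0// -!powRrM.
  by congr (_ `^ _); ring.
rewrite /cutoff_cost !powRM ?mulr_ge0 ?mulrn_wge0 ?invr_ge0 ?exprn_ge0
  ?(ltW r0) ?(ltW T0)//.
rewrite Ti ri opprB powRD; last by rewrite (gt_eqF r0) implybT.
rewrite powR_mulrn ?(ltW r0)// -[r *+ 2]mulr_natr exprMn.
by field; rewrite !gt_eqF.
Qed.

Lemma nonneg_part_integral0 s : 0 < s ->
  (\int[lebesgue_rV N]_(x in rV_cube s) (gp x)%:E = 0)%E.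
Proof.
move=> s0; have gp0 x : 0 <= gp x by rewrite le_max lexx orbT.
set q' := q / (q - 1); set p' := p / (p - 1).
have q'0 : 0 < q' by rewrite divr_gt0 ?subr_gt0// (lt_trans ltr01).
have pp : 0 < 2 * p' - N%:R by rewrite subr_gt0 subcritical_conjugate.
(* A single [l], depending on [p] and [q] only, meets both lower bounds on the exponent of the
   bumps. *)
pose l := Num.truncn (2 * p' + q').
have p'0 : 0 < 2 * p' by rewrite (le_lt_trans _ subcritical_conjugate).
have lE : 2 * p' + q' <= l.+3%:R.
  apply: (@le_trans _ _ l.+1%:R); first exact/ltW/truncnS_gt.
  by rewrite ler_nat !ltnS leqW.
have pl : 2 * p' <= l.+3%:R by apply: le_trans lE; rewrite lerDl ltW.
have ql : q' <= l.+3%:R by apply: le_trans lE; rewrite lerDr ltW.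
have [C C0 HC] := cutoff_bound pl ql.
apply/eqP; rewrite eq_le integral_ge0 ?andbT; last first.
  by move=> x _; rewrite lee_fin.
apply/lee_addgt0Pr => e e0; rewrite add0e.
have e20 : 0 < e / 2 by rewrite divr_gt0.
pose A : R := (N%:R * (10 * l.+3%:R ^+ 2)) `^ p'.
have [X X0 HX] := powR_vanish pp (mulr_ge0 C0 (powR_ge0 _ _ : 0 <= A)) e20.
(* [r] makes the second error at most [e / 2] and the inner cube contain the given one; [T] comes
   afterwards, because the coefficient [D] of [T^-q'] grows with [r]. *)
pose r := Num.max X (2 * s); have r0 : 0 < r by rewrite lt_max X0.
pose D : R := r `^ N%:R * (l.+3%:R *+ 2) `^ q'.
have D0 : 0 <= D by rewrite mulr_ge0 ?powR_ge0.
have [T T0 HT] := powR_vanish q'0 (mulr_ge0 C0 D0) e20.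
have sr : @rV_cube R N s `<=` rV_cube (r / 2).
  have sr2 : s <= r / 2 by rewrite ler_pdivlMr// mulrC le_max lexx orbT.
  move=> x xs i; have := xs i; rewrite /= !in_itv/= => /andP[? ?].
  by apply/andP; split; lra.
have mgp : measurable_fun [set: 'rV[R]_N] (EFin \o gp).
  apply/measurable_EFinP; have [mg _] := gL1.
  by apply: measurable_maxr => //; exact: measurable_cst.
apply: (@le_trans _ _ (\int[lebesgue_rV N]_(x in rV_cube (r / 2)) (gp x)%:E)%E).
  apply: ge0_subset_integral => //.
  - exact: rV_cube_measurable.
  - exact: rV_cube_measurable.
  - exact: measurable_funTS mgp.
  - by move=> x _; rewrite lee_fin.
apply: le_trans (HC T r T0 r0) _; rewrite lee_fin.
have Xr : X <= r by rewrite le_max lexx.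
have := HX r Xr; have := HT T (lexx _).
rewrite /D /A mulrDr !mulrA => HT' HX'.
by rewrite [e]splitr; apply: lerD.
Qed.

(** A nonnegative function with zero integral vanishes almost everywhere on each cube, and countably
    many cubes cover the space. *)
Lemma source_ae0 : {ae lebesgue_rV N, forall x, g x = 0}.
Proof.
have H n : {ae lebesgue_rV N, forall x, rV_cube n.+1%:R x -> gp x = 0}.
  have mgp : measurable_fun (rV_cube n.+1%:R) (EFin \o gp).
    apply: measurable_funTS; apply/measurable_EFinP; have [mg _] := gL1.
    by apply: measurable_maxr => //; exact: measurable_cst.
  have := ae_eq_integral_abs (lebesgue_rV N) (@rV_cube_measurable R N n.+1%:R) mgp.
  move=> [/(_ _) H _]; have {H} := H _; rewrite /ae_eq.
  have -> : (\int[lebesgue_rV N]_(x in rV_cube n.+1%:R) `|(EFin \o gp) x| = 0)%E.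
    rewrite -(@nonneg_part_integral0 n.+1%:R) ?ltr0n//.
    by apply: eq_integral => x _; rewrite /= ger0_norm// le_max lexx orbT.
  by move=> /(_ erefl); apply: filterS => x + xn => /(_ xn)[].
have := ae_foralln H; apply: filterS2 g0 => x gx Hx.
have := Hx (Num.truncn `|x|); rewrite /gp max_l//; apply => i.
rewrite /= in_itv/= -ler_norml (le_trans (rV_coord_norm x i))// ltW//.
exact: truncnS_gt.
Qed.

End nonexistence.

Theorem theorem1p6 (R : realType) (k N : nat) (p q : R)
    (hk : (2 <= k)%N) (hN : (1 <= N)%N) (hp : 1 < p) (hq : 1 < q) :
  ((p%:E < pstar R N)%E ->
   forall g : 'rV[R]_N -> R,
     L1_loc_space g ->
     {ae lebesgue_rV N, forall x, 0 <= g x} ->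
     ~ {ae lebesgue_rV N, forall x, g x = 0} ->
     ~ exists u v : R * 'rV[R]_N -> R,
         weak_solution k p q (fun z => g z.2) u v) /\
  ((3 <= N)%N -> (pstar R N < p%:E)%E ->
   exists (g : 'rV[R]_N -> R) (u0 : 'I_k -> 'rV[R]_N -> R)
          (u v : R * 'rV[R]_N -> R),
     [/\ L1_loc_space g,
         (forall x, 0 < g x),
         (forall z, halfspace z -> 0 < u z),
         weak_solution k p q (fun z => g z.2) u v &
         has_initial_values u u0]).
Proof.
split=> [pN g gL1 g0 gn0 [u [v uv]]|N3 pN].
  exact/gn0/(source_ae0 hN hp hq pN gL1 g0 uv).
exact: supercritical_solution.
Qed.
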